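(* Let $\Bbbk$ be an algebraically closed field of arbitrary characteristic and $G$ a finite group. Consider data $(H,N,\gamma,\epsilon)$ where: $H$ is a subgroup of $G$ with $|G:H|\in\Bbbk^\times$; $N\triangleleft H$ is a normal subgroup with $|N|\in\Bbbk^\times$; $\gamma\in Z^2(N,\Bbbk^\times)$ is a normalized $2$-cocycle, i.e. $\gamma(n,m)\gamma(nm,r)=\gamma(n,mr)\gamma(m,r)$ and $\gamma(n,1_N)=\gamma(1_N,n)=1$; and $\epsilon:H\times N\to\Bbbk^\times$, $(h,n)\mapsto\epsilon_h(n)$, is a map such that for all $g,h\in H$, $n,m\in N$, $$\epsilon_{gh}(n)=\epsilon_g(hnh^{-1})\epsilon_h(n),\qquad \epsilon_h(nm)\gamma(n,m)=\epsilon_h(n)\epsilon_h(m)\gamma(hnh^{-1},hmh^{-1}),\qquad \gamma(n,m)=\epsilon_n(m)\gamma(nmn^{-1},n).$$ Fix a coset decomposition $G=\bigsqcup_{i\in I}g_iH$. (1) Let $A(H,N,\gamma,\epsilon)$ be the quotient $\Bbbk$-vector space spanned by $\{a_{g,n}\mid g\in G,\ n\in N\}$, subject to the relations $a_{gh,n}=\epsilon_h(n)\,a_{g,hnh^{-1}}$ for all $h\in H$, with (i) left $\Bbbk G$-action $k\cdot a_{g,n}=a_{kg,n}$ for $k\in G$; (ii) left $\Bbbk G$-coaction $\delta(a_{g,n})=gng^{-1}\otimes a_{g,n}$; (iii) multiplication $$a_{g,n}a_{k,m}=\delta_{gH,kH}\;\gamma(k^{-1}gng^{-1}k,m)\;\epsilon_{k^{-1}g}(n)\;a_{k,\,k^{-1}gng^{-1}km},\qquad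 g,k\in G,\ n,m\in N;$$ (iv) unit $1_A=\sum_{i\in I}a_{g_i,1_N}$. Then $A(H,N,\gamma,\epsilon)$ is a connected, commutative algebra in $\mathcal{Z}(\Bbbk G\text{-}\mathsf{Mod})\simeq{}^{\Bbbk G}_{\Bbbk G}\mathsf{YD}$. (2) Further, $A(H,N,\gamma,\epsilon)$ is a rigid Frobenius algebra in $\mathcal{Z}(\Bbbk G\text{-}\mathsf{Mod})$ with $$\Delta_A(a_{g,n})=\sum_{m\in N}\frac{\gamma(m^{-1},n)}{\gamma(m^{-1},m)}\;a_{g,m}\otimes a_{g,m^{-1}n},\qquad\varepsilon_A(a_{g,n})=\delta_{n,1_N}1_\Bbbk,$$ for all $g\in G$, $n\in N$. (3) Every rigid Frobenius algebra in $\mathcal{Z}(\Bbbk G\text{-}\mathsf{Mod})$ is isomorphic to one of the form $A(H,N,\gamma,\epsilon)$, for some choice of data $H,N,\gamma,\epsilon$.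
   Context: $\Bbbk G\text{-}\mathsf{Mod}$ denotes finite-dimensional $\Bbbk G$-modules and $\mathcal{Z}(-)$ the monoidal (Drinfeld) center, identified with the braided category ${}^{\Bbbk G}_{\Bbbk G}\mathsf{YD}$ of finite-dimensional left Yetter–Drinfeld modules: $G$-graded spaces (coaction $\delta(v)=g\otimes v$ for $v$ of degree $g$) with a $G$-action such that $k\cdot v$ has degree $kgk^{-1}$; the braiding is $c(v\otimes w)=g\cdot w\otimes v$ for $v$ of degree $g$. In (iii), note that $k^{-1}g\in H$ iff $gH=kH$. An algebra $A$ in a braided category is commutative if $m=mc_{A,A}$, connected if $\dim_\Bbbk\mathrm{Hom}(\mathbf 1,A)=1$. A Frobenius algebra is $(A,m,u,\Delta,\varepsilon)$ with $(A,m,u)$ an algebra, $(A,\Delta,\varepsilon)$ a coalgebra and $(m\otimes\mathrm{id})(\mathrm{id}\otimes\Delta)=\Delta m=(\mathrm{id}\otimes m)(\Delta\otimes\mathrm{id})$; it is special if $m\Delta=\beta_A\mathrm{id}_A$ and $\varepsilon u=\beta_{\mathbf 1}\mathrm{id}_{\mathbf 1}$ for some $\beta_A,\beta_{\mathbf 1}\in\Bbbk^\times$. A rigid Frobenius algebra is a connected, commutative, special Frobenius algebra.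
   Formalization: In (3), ''isomorphic'' means an isomorphism of algebras in the Yetter–Drinfeld category that respects Δ and ε up to a scalar c and its inverse; strict Frobenius isomorphism fails, e.g. for G=1, A=k with Δ(1)=c·1⊗1, ε(1)=1/c, c≠1. *)

(* Defs.v *)
From HB Require Import structures.
From mathcomp Require Import all_boot all_order all_fingroup all_algebra.

Set Implicit Arguments.
Unset Strict Implicit.
Unset Printing Implicit Defensive.

Import GRing.Theory.
Local Open Scope ring_scope.

(** * Tensor products of finite-dimensional vector spaces

    [tensv V W] consists of the coordinate matrices of tensors with respect to
    the bases [vbasis {:V}] and [vbasis {:W}].  [tlift f] is the linear map
    induced by a bilinear [f] ([tlift_tens]); it is meaningless when [f] is not
    bilinear. *)

Section Tensor.
Variable k : fieldType.
Implicit Types V W U X : vectType k.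

Definition tensv V W : vectType k := 'M[k]_(\dim {:V}, \dim {:W}).

Definition tens V W (v : V) (w : W) : tensv V W :=
  \matrix_(i, j) (coord (vbasis {:V}) i v * coord (vbasis {:W}) j w).

Definition tlift V W U (f : V -> W -> U) : 'Hom(tensv V W, U) :=
  linfun (fun A : tensv V W =>
    \sum_i \sum_j A i j *: f (vbasis {:V})`_i (vbasis {:W})`_j).

Definition tensl V W V' W' (f : 'Hom(V, V')) (g : 'Hom(W, W')) :
    'Hom(tensv V W, tensv V' W') :=
  tlift (fun v w => tens (f v) (g w)).

Definition tassoc V W U : 'Hom(tensv (tensv V W) U, tensv V (tensv W U)) :=
  tlift (fun x u => tlift (fun v w => tens v (tens w u)) x).

Definition tassoc_inv V W U :
    'Hom(tensv V (tensv W U), tensv (tensv V W) U) :=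
  tlift (fun v x => tlift (fun w u => tens (tens v w) u) x).

Definition tunitl V : 'Hom(tensv k^o V, V) :=
  tlift (fun (c : k^o) v => (c : k) *: v).

Definition tunitr V : 'Hom(tensv V k^o, V) :=
  tlift (fun v (c : k^o) => (c : k) *: v).

Definition tensU V W (A : {vspace V}) (B : {vspace W}) : {vspace tensv V W} :=
  <<[seq tens v w | v <- vbasis A, w <- vbasis B]>>%VS.

Lemma tens_linearl V W (w : W) : linear (fun v : V => tens v w).
Proof.
move=> a v v'; apply/matrixP=> i j.
by rewrite !mxE linearP /= mulrDl -mulrA.
Qed.

Lemma tens_linearr V W (v : V) : linear (fun w : W => tens v w).
Proof.
move=> a w w'; apply/matrixP=> i j.
by rewrite !mxE linearP /= mulrDr mulrCA.
Qed.

HB.instance Definition _ V W (v : V) :=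
  GRing.isLinear.Build k W (tensv V W) *:%R (tens v) (@tens_linearr V W v).

Lemma tens_suml V W (w : W) (I : Type) (r : seq I) (P : pred I) (F : I -> V) :
  tens (\sum_(i <- r | P i) F i) w = \sum_(i <- r | P i) tens (F i) w.
Proof.
pose h := linfun (fun v : V => tens v w : tensv V W).
pose hl := GRing.isLinear.Build k V (tensv V W) *:%R
             (fun v : V => tens v w) (@tens_linearl V W w).
pose hL : {linear V -> tensv V W} := HB.pack (fun v : V => tens v w) hl.
exact: (raddf_sum hL).
Qed.

Lemma tensZl V W (w : W) a (v : V) : tens (a *: v) w = a *: tens v w.
Proof. by apply/matrixP=> i j; rewrite !mxE linearZ /= mulrA. Qed.

Lemma tliftE V W U (f : V -> W -> U) (A : tensv V W) :
  tlift f A = \sum_i \sum_j A i j *: f (vbasis {:V})`_i (vbasis {:W})`_j.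
Proof.
pose F (B : tensv V W) :=
  \sum_i \sum_j B i j *: f (vbasis {:V})`_i (vbasis {:W})`_j.
have linF : linear F.
  move=> a B C; rewrite /F scaler_sumr -big_split /=; apply: eq_bigr => i _.
  rewrite scaler_sumr -big_split /=; apply: eq_bigr => j _.
  by rewrite !mxE scalerDl scalerA.
pose Fm := GRing.isLinear.Build k (tensv V W) U *:%R F linF.
pose FL : {linear tensv V W -> U} := HB.pack F Fm.
exact: (lfunE FL).
Qed.

Lemma tlift_tens V W U (f : V -> W -> U) (v : V) (w : W) :
  (forall w, linear (f^~ w)) -> (forall v, linear (f v)) ->
  tlift f (tens v w) = f v w.
Proof.
move=> lin1 lin2.
rewrite tliftE [in RHS](coord_vbasis (memvf v)).
pose f1 w' : {linear V -> U} := HB.pack (f^~ w')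
  (GRing.isLinear.Build k V U *:%R (f^~ w') (lin1 w')).
pose f2 v' : {linear W -> U} := HB.pack (f v')
  (GRing.isLinear.Build k W U *:%R (f v') (lin2 v')).
rewrite -[RHS]/(f1 w _) linear_sum; apply: eq_bigr => i _.
rewrite linearZ /= [in RHS](coord_vbasis (memvf w)).
rewrite -[f _ _ in RHS]/(f2 _ _) linear_sum scaler_sumr.
by apply: eq_bigr => j _; rewrite mxE linearZ /= scalerA.
Qed.

Lemma tens_expand V W (A : tensv V W) :
  A = \sum_i \sum_j A i j *: tens (vbasis {:V})`_i (vbasis {:W})`_j.
Proof.
have coordb (X : vectType k) (i j : 'I_(\dim {:X})) :
    coord (vbasis {:X}) i (vbasis {:X})`_j = (j == i)%:R.
  by rewrite coord_free ?(basis_free (vbasisP _)).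
apply/matrixP=> i j; rewrite summxE.
transitivity (\sum_i' \sum_j' A i' j' * ((i' == i)%:R * (j' == j)%:R)).
  rewrite (bigD1 i) //= [X in _ + X]big1 ?addr0 => [|i' /negbTE ne]; last first.
    by rewrite big1 // => j' _; rewrite ne mul0r mulr0.
  rewrite (bigD1 j) //= big1 ?addr0 => [|j' /negbTE ne]; last first.
    by rewrite ne !mulr0.
  by rewrite !eqxx !mulr1.
apply: eq_bigr => i' _; rewrite summxE; apply: eq_bigr => j' _.
by rewrite !mxE !coordb.
Qed.

Lemma memv_tensU V W (A : {vspace V}) (B : {vspace W}) v w :
  v \in A -> w \in B -> tens v w \in tensU A B.
Proof.
move=> vA wB; rewrite (coord_vbasis vA) (coord_vbasis wB).
rewrite tens_suml memv_suml // => i _; rewrite linear_sum memv_suml // => j _.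
rewrite /= tensZl linearZ !rpredZ //; apply: memv_span.
by apply: allpairs_f; apply: mem_nth; rewrite size_tuple.
Qed.

Lemma dim_tensU V W (A : {vspace V}) (B : {vspace W}) :
  (\dim (tensU A B) <= \dim A * \dim B)%N.
Proof.
by apply: leq_trans (dim_span _) _; rewrite size_allpairs !size_tuple.
Qed.

Lemma tensl_tens V W V' W' (f : 'Hom(V, V')) (g : 'Hom(W, W')) v w :
  tensl f g (tens v w) = tens (f v) (g w).
Proof.
apply: tlift_tens => [w'|v'] a x y; rewrite linearP.
  exact: tens_linearl.
exact: tens_linearr.
Qed.

Lemma lfun_tensP V W U (f g : 'Hom(tensv V W, U)) :
  (forall v w, f (tens v w) = g (tens v w)) -> f = g.
Proof.
move=> fg; apply/lfunP => A; rewrite (tens_expand A) !linear_sum.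
apply: eq_bigr => i _; rewrite !linear_sum; apply: eq_bigr => j _.
by rewrite !linearZ /= fg.
Qed.

Lemma tensl_tensU V W V' W' (f : 'Hom(V, V')) (g : 'Hom(W, W'))
    (A : {vspace V}) (B : {vspace W}) (A' : {vspace V'}) (B' : {vspace W'}) :
  (forall v, v \in A -> f v \in A') -> (forall w, w \in B -> g w \in B') ->
  forall x, x \in tensU A B -> tensl f g x \in tensU A' B'.
Proof.
move=> fA gB x xAB; rewrite memv_preim; move: x xAB; apply/subvP/span_subvP.
move=> _ /allpairsP[[v w] /= [vA wB ->]].
by rewrite -memv_preim tensl_tens memv_tensU ?fA ?gB // vbasis_mem.
Qed.

End Tensor.

(** * Finite-dimensional Yetter-Drinfeld modules over the group algebra of [gT]

    The grading encodes the coaction: [v \in yd_gr Y g] means that the coaction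
    sends [v] to the tensor product of [g] and [v]. *)

Section YetterDrinfeld.
Variables (k : fieldType) (gT : finGroupType).
Implicit Types V W U : vectType k.

Record ydStruct V := YDStruct {
  yd_act : gT -> 'End(V);
  yd_gr : gT -> {vspace V};
  yd_act1 : yd_act 1%g = \1%VF;
  yd_actM : forall g h, yd_act (g * h)%g = (yd_act g \o yd_act h)%VF;
  yd_gr_full : (\sum_g yd_gr g)%VS = fullv;
  yd_gr_direct : directv (\sum_g yd_gr g)%VS;
  yd_act_gr : forall x g v,
    v \in yd_gr g -> yd_act x v \in yd_gr (x * g * x^-1)%g
}.

Definition yd_comp V (Y : ydStruct V) (g : gT) : 'End(V) :=
  sumv_pi (\sum_h yd_gr Y h)%VS g.

Lemma yd_comp_sum V (Y : ydStruct V) v : \sum_g yd_comp Y g v = v.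
Proof. by apply: sumv_pi_sum; rewrite yd_gr_full memvf. Qed.

Lemma yd_comp_mem V (Y : ydStruct V) g v : yd_comp Y g v \in yd_gr Y g.
Proof. exact: memv_sum_pi. Qed.

Definition is_ydmor V W (Y : ydStruct V) (Z : ydStruct W) (f : 'Hom(V, W)) :=
  (forall g v, f (yd_act Y g v) = yd_act Z g (f v)) /\
  (forall g v, v \in yd_gr Y g -> f v \in yd_gr Z g).

Definition unit_gr (g : gT) : {vspace k^o} :=
  if g == 1%g then fullv else 0%VS.

Lemma unit_gr_full : (\sum_g unit_gr g)%VS = fullv.
Proof.
rewrite (bigD1 1%g) //= big1 => [|g /negbTE ne]; rewrite /unit_gr ?ne //.
by rewrite eqxx addv0.
Qed.

Lemma directv_dim V (gr : gT -> {vspace V}) :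
  (\sum_g gr g)%VS = fullv -> (\sum_g \dim (gr g) <= \dim {:V})%N ->
  directv (\sum_g gr g)%VS.
Proof. by move=> full dim_le; rewrite directvEgeq /= full. Qed.

Lemma unit_gr_dim : (\sum_g \dim (unit_gr g) <= \dim {:k^o})%N.
Proof.
rewrite (bigD1 1%g) //= big1 ?addn0 => [|g /negbTE ne].
  by rewrite /unit_gr eqxx.
by rewrite /unit_gr ne dimv0.
Qed.

Lemma unit_act_gr (x g : gT) (v : k^o) :
  v \in unit_gr g -> \1%VF v \in unit_gr (x * g * x^-1)%g.
Proof.
rewrite id_lfunE /unit_gr; case: eqP => [->|_]; first by rewrite mulg1 mulgV eqxx.
by rewrite memv0 => /eqP ->; rewrite mem0v.
Qed.

Definition ydUnit : ydStruct k^o := {|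
  yd_act := fun _ => \1%VF;
  yd_gr := unit_gr;
  yd_act1 := erefl;
  yd_actM := fun _ _ => esym (comp_lfun1l _);
  yd_gr_full := unit_gr_full;
  yd_gr_direct := directv_dim unit_gr_full unit_gr_dim;
  yd_act_gr := unit_act_gr |}.

Section YDTensor.
Variables (V W : vectType k) (Y : ydStruct V) (Z : ydStruct W).

Definition tens_act g : 'End(tensv V W) := tensl (yd_act Y g) (yd_act Z g).

Definition tens_gr g : {vspace tensv V W} :=
  (\sum_h tensU (yd_gr Y h) (yd_gr Z (h^-1 * g)%g))%VS.

Lemma tens_act1 : tens_act 1%g = \1%VF.
Proof.
by apply: lfun_tensP => v w; rewrite tensl_tens !yd_act1 !id_lfunE.
Qed.

Lemma tens_actM g h : tens_act (g * h)%g = (tens_act g \o tens_act h)%VF.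
Proof.
apply: lfun_tensP => v w.
by rewrite comp_lfunE !tensl_tens !yd_actM !comp_lfunE.
Qed.

Lemma tens_gr_full : (\sum_g tens_gr g)%VS = fullv.
Proof.
apply/eqP; rewrite eqEsubv subvf; apply/subvP => A _.
rewrite (tens_expand A) memv_suml // => i _; rewrite memv_suml // => j _.
rewrite rpredZ // -[_`_i](yd_comp_sum Y) -[_`_j](yd_comp_sum Z).
rewrite tens_suml memv_suml // => h _; rewrite linear_sum memv_suml // => g _.
rewrite /=.
apply: (subvP (sumv_sup (h * g)%g _ (subvv _))) => //.
apply: (subvP (sumv_sup h _ (subvv _))) => //.
by rewrite mulKg memv_tensU // yd_comp_mem.
Qed.

Lemma tens_gr_dim : (\sum_g \dim (tens_gr g) <= \dim {:tensv V W})%N.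
Proof.
apply: (@leq_trans
  (\sum_g \sum_h \dim (yd_gr Y h) * \dim (yd_gr Z (h^-1 * g)%g))%N).
  apply: leq_sum => g _; apply: leq_trans (dimv_leq_sum _ _ _) _.
  by apply: leq_sum => h _; apply: dim_tensU.
rewrite exchange_big /=.
have -> : \dim {:tensv V W} = (\dim {:V} * \dim {:W})%N by rewrite dimvf.
rewrite -(yd_gr_full Y) -(yd_gr_full Z).
rewrite (directvP (yd_gr_direct Y)) (directvP (yd_gr_direct Z)) /=.
rewrite big_distrl /=; apply: leq_sum => h _.
rewrite -big_distrr leq_mul2l; apply/orP; right.
rewrite (reindex_inj (mulgI h)) /=; apply: leq_sum => g _.
by rewrite mulKg.
Qed.

Lemma tens_act_gr x g A :
  A \in tens_gr g -> tens_act x A \in tens_gr (x * g * x^-1)%g.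
Proof.
move=> /memv_sumP[a a_in ->]; rewrite linear_sum memv_suml // => h _.
apply: (subvP (sumv_sup (x * h * x^-1)%g _ (subvv _))) => //.
have := a_in h isT; move: (a h); apply: tensl_tensU => [v|w] /(yd_act_gr x) //.
by congr (_ \in yd_gr Z _); rewrite !invMg invgK !mulgA mulgKV.
Qed.

Definition ydTens : ydStruct (tensv V W) := {|
  yd_act := tens_act;
  yd_gr := tens_gr;
  yd_act1 := tens_act1;
  yd_actM := tens_actM;
  yd_gr_full := tens_gr_full;
  yd_gr_direct := directv_dim tens_gr_full tens_gr_dim;
  yd_act_gr := tens_act_gr |}.

Definition ydBraid : 'Hom(tensv V W, tensv W V) :=
  tlift (fun v w => \sum_g tens (yd_act Z g w) (yd_comp Y g v)).

End YDTensor.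

(** * Algebras, coalgebras and Frobenius algebras *)

Section Algebras.
Variables (V : vectType k) (Y : ydStruct V).
Variables (m : 'Hom(tensv V V, V)) (u : 'Hom(k^o, V)).
Variables (D : 'Hom(V, tensv V V)) (e : 'Hom(V, k^o)).

Record is_yd_algebra : Prop := {
  yda_mul_mor : is_ydmor (ydTens Y Y) Y m;
  yda_unit_mor : is_ydmor ydUnit Y u;
  yda_assoc : (m \o tensl m \1 = m \o tensl \1 m \o tassoc V V V)%VF;
  yda_unitl : (m \o tensl u \1)%VF = tunitl V;
  yda_unitr : (m \o tensl \1 u)%VF = tunitr V
}.

Record is_yd_coalgebra : Prop := {
  ydc_comul_mor : is_ydmor Y (ydTens Y Y) D;
  ydc_counit_mor : is_ydmor Y ydUnit e;
  ydc_coassoc : (tassoc V V V \o tensl D \1 \o D = tensl \1 D \o D)%VF;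
  ydc_counitl : (tunitl V \o tensl e \1 \o D)%VF = \1%VF;
  ydc_counitr : (tunitr V \o tensl \1 e \o D)%VF = \1%VF
}.

Definition is_commutative := m = (m \o ydBraid Y Y)%VF.

(* [H] is the space of all morphisms from the unit object to [V]. *)
Definition is_connected :=
  exists2 H : {vspace 'Hom(k^o, V)},
    (forall f, f \in H <-> is_ydmor ydUnit Y f) & \dim H = 1%N.

Record is_frobenius : Prop := {
  frob_alg : is_yd_algebra;
  frob_coalg : is_yd_coalgebra;
  frob_left : (tensl m \1 \o tassoc_inv V V V \o tensl \1 D = D \o m)%VF;
  frob_right : (D \o m = tensl \1 m \o tassoc V V V \o tensl D \1)%VF
}.

Definition is_special :=
  exists bA b1 : k,
    [/\ bA != 0, b1 != 0, (m \o D)%VF = bA *: \1%VF & (e \o u)%VF = b1 *: \1%VF].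

Definition is_rigid_frobenius :=
  [/\ is_frobenius, is_connected, is_commutative & is_special].

End Algebras.

Definition is_yd_iso V W (Y : ydStruct V) (Z : ydStruct W) (f : 'Hom(V, W)) :=
  is_ydmor Y Z f /\
  exists f' : 'Hom(W, V),
    [/\ is_ydmor Z Y f', (f' \o f)%VF = \1%VF & (f \o f')%VF = \1%VF].

(* An isomorphism of algebras which is compatible with the coalgebra structures
   up to the rescaling of comultiplication by [c] and of counit by [c^-1].  Such
   a rescaling preserves rigid Frobenius algebras, so the scalar [c] cannot be
   avoided in a classification where comultiplication and counit are
   normalized. *)
Definition is_rigid_frobenius_iso
    V (Y : ydStruct V) (m : 'Hom(tensv V V, V)) (u : 'Hom(k^o, V))
      (D : 'Hom(V, tensv V V)) (e : 'Hom(V, k^o))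
    W (Z : ydStruct W) (m' : 'Hom(tensv W W, W)) (u' : 'Hom(k^o, W))
      (D' : 'Hom(W, tensv W W)) (e' : 'Hom(W, k^o))
    (f : 'Hom(V, W)) :=
  [/\ is_yd_iso Y Z f,
      (f \o m = m' \o tensl f f)%VF,
      (f \o u)%VF = u' &
      exists2 c : k, c != 0 &
        (D' \o f)%VF = c *: (tensl f f \o D)%VF /\
        (e' \o f)%VF = c^-1 *: e].

End YetterDrinfeld.

Arguments ydUnit {k gT}.

(** * The algebras A(H, N, gamma, epsilon) *)

Section QuotientSpace.
Variables (k : fieldType) (V : vectType k) (U : {vspace V}).

(* The quotient of [V] by [U], realized on a complement of [U]. *)
Definition quotv : vectType k := subvs_of (U^C)%VS.

Definition quot_pi : 'Hom(V, quotv) :=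
  (linfun (vsproj (U^C)%VS) \o daddv_pi (U^C)%VS U)%VF.

Lemma capv_complC : (U^C :&: U = 0)%VS.
Proof. by rewrite capvC capv_compl. Qed.

Lemma quot_pi_eq0 v : (quot_pi v == 0) = (v \in U).
Proof.
have dec : daddv_pi (U^C)%VS U v + daddv_pi U (U^C)%VS v = v.
  by apply: daddv_pi_add; rewrite ?capv_complC // addvC addv_complf memvf.
rewrite comp_lfunE lfunE /=; apply/eqP/idP => [v0|vU].
  rewrite -dec; move/(congr1 vsval): v0; rewrite vsprojK ?memv_pi //= => ->.
  by rewrite add0r memv_pi.
suff -> : daddv_pi (U^C)%VS U v = 0 by rewrite linear0.
by apply: (addIr (daddv_pi U (U^C)%VS v)); rewrite dec add0r daddv_pi_id ?capv_compl.
Qed.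

Lemma quot_pi_surj x : exists v, quot_pi v = x.
Proof.
exists (vsval x); rewrite comp_lfunE lfunE /= daddv_pi_id ?capv_complC ?subvsP //.
exact: vsvalK.
Qed.

End QuotientSpace.

Section Data.
Variables (k : fieldType) (gT : finGroupType).

(* Only the values of [dat_gamma] on N x N and of [dat_eps] on H x N matter. *)
Record datum := Datum {
  dat_H : {group gT};
  dat_N : {group gT};
  dat_gamma : gT -> gT -> k;
  dat_eps : gT -> gT -> k;
  dat_indexH : #|[set: gT] : dat_H|%g%:R != 0 :> k;
  dat_normal : (dat_N <| dat_H)%g;
  dat_cardN : #|dat_N|%:R != 0 :> k;
  dat_gamma_neq0 : {in dat_N &, forall n m, dat_gamma n m != 0};
  dat_gamma_cocycle : {in dat_N & &, forall n m r,
    dat_gamma n m * dat_gamma (n * m)%g r =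
    dat_gamma n (m * r)%g * dat_gamma m r};
  dat_gamma_norm : {in dat_N, forall n,
    dat_gamma n 1%g = 1 /\ dat_gamma 1%g n = 1};
  dat_eps_neq0 : {in dat_H & dat_N, forall h n, dat_eps h n != 0};
  dat_eps_mulH : {in dat_H & dat_H & dat_N, forall g h n,
    dat_eps (g * h)%g n = dat_eps g (h * n * h^-1)%g * dat_eps h n};
  dat_eps_mulN : {in dat_H & dat_N & dat_N, forall h n m,
    dat_eps h (n * m)%g * dat_gamma n m =
    dat_eps h n * dat_eps h m *
      dat_gamma (h * n * h^-1)%g (h * m * h^-1)%g};
  dat_eps_comm : {in dat_N &, forall n m,
    dat_gamma n m = dat_eps n m * dat_gamma (n * m * n^-1)%g n}
}.

Variable d : datum.
Local Notation H := (dat_H d).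
Local Notation N := (dat_N d).
Local Notation gamma := (dat_gamma d).
Local Notation eps := (dat_eps d).

(* The vector space with basis G x N. *)
Definition freeGN : vectType k := {ffun gT * [subg N] -> k^o}.

(* [subg N n] is [n] as an element of the subtype [[subg N]] when [n \in N]. *)
Definition free_gen (g n : gT) : freeGN :=
  [ffun x => (x == (g, subg N n))%:R].

Definition rel_space : {vspace freeGN} :=
  <<[seq free_gen (x.1.1 * x.1.2)%g x.2 -
         eps x.1.2 x.2 *: free_gen x.1.1 (x.1.2 * x.2 * x.1.2^-1)%g
      | x : gT * gT * gT in [pred x | (x.1.2 \in H) && (x.2 \in N)]]>>%VS.

Definition Asp : vectType k := quotv rel_space.

Definition a_ (g n : gT) : Asp := quot_pi rel_space (free_gen g n).

Definition is_coset_decomposition (I : finType) (r : I -> gT) :=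
  forall x : gT, exists! i : I, x \in (r i *: H)%g.

Record is_A_algebra (I : finType) (r : I -> gT) (Y : ydStruct gT Asp)
    (mul : 'Hom(tensv Asp Asp, Asp)) (u : 'Hom(k^o, Asp)) : Prop := {
  A_act : forall x g n, n \in N -> yd_act Y x (a_ g n) = a_ (x * g)%g n;
  A_coact : forall g n, n \in N -> a_ g n \in yd_gr Y (g * n * g^-1)%g;
  A_mul : forall g x n m, n \in N -> m \in N ->
    mul (tens (a_ g n) (a_ x m)) =
      if (g *: H == x *: H)%g then
        (gamma (x^-1 * g * n * g^-1 * x)%g m * eps (x^-1 * g)%g n) *:
          a_ x (x^-1 * g * n * g^-1 * x * m)%g
      else 0;
  A_unit : u 1 = \sum_i a_ (r i) 1%g
}.

Record is_A_coalgebra (D : 'Hom(Asp, tensv Asp Asp)) (e : 'Hom(Asp, k^o)) :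
    Prop := {
  A_comul : forall g n, n \in N ->
    D (a_ g n) = \sum_(m in N) (gamma m^-1%g n / gamma m^-1%g m) *:
                   tens (a_ g m) (a_ g (m^-1 * n)%g);
  A_counit : forall g n, n \in N -> e (a_ g n) = (n == 1%g)%:R
}.

Lemma a_rel g h n : h \in H -> n \in N ->
  a_ (g * h)%g n = eps h n *: a_ g (h * n * h^-1)%g.
Proof.
move=> hH nN; apply/eqP; rewrite -subr_eq0 /a_ -linearZ -linearB quot_pi_eq0.
apply: memv_span; apply/imageP; exists (g, h, n) => //=.
by rewrite unfold_in /= hH nN.
Qed.

End Data.

(* Main.v *)
From HB Require Import structures.
Require Import Defs.
From mathcomp Require Import all_boot all_order all_fingroup all_algebra ring.

(** Why the theorem holds.

    The algebra of a datum.  By the relations, a generator [a_ g n] is a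
    multiple of some [a_ x n'] for each [x] in the coset of [g] ([gen_move]), and
    generators over different cosets multiply to zero.  So the
    algebra is a product, indexed by the cosets, of copies of the twisted group
    algebra of [N] by [gamma].  All axioms can be checked on generators
    ([gen_ext], [gen_ind]): associativity, the Frobenius identities and
    coassociativity reduce to the cocycle identity, commutativity is the relation
    between [eps] on [N] and [gamma], and the laws of [eps] say that the
    operations respect the relations.  An invariant of trivial degree is a
    combination of the idempotents [a_ g 1] with equal coefficients, whence
    connectedness; the two scalars of speciality are [#|N|] and the index of [H].

    The classification.  Let [V] be a rigid Frobenius algebra, [A1] its part of
    trivial degree and [e] its counit.  Homogeneous elements of trivial degree
    braid trivially, so [A1] is central.  Speciality provides a separability
    element, the multiple of [D 1] whose product is [1]; averaging a linear
    projection over it shows that [A1] is von Neumann regular ([regular1]).  Over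
    an algebraically closed field it follows that [A1] contains a primitive
    idempotent [p], one with [p A1 = k p] ([primitive1_exists]).  By connectedness
    the translates of [p] are orthogonal idempotents with sum [1]
    ([idem_orth], [sum_translates]).  Thus [V] is the sum of the translates of the
    block [p V], on which the stabilizer [H] of [p] acts.

    The form [e (v w)] is nondegenerate and pairs inverse degrees, and the block
    has trivial degree part [k p].  Hence nonzero homogeneous elements of the
    block are invertible ([block_inv]), its nonzero components are lines, and
    their degrees form a subgroup [N], normal in [H].  A choice of generators
    [block_gen n] of these lines defines [gamma] by multiplication and [eps] by
    the action of [H]; the laws of a datum are associativity, multiplicativity of
    the action and commutativity.  The cardinal of [N] and the index of [H] are
    nonzero in [k] because, up to powers of [e p], they are the scalars of
    speciality ([card_supp_neq0], [index_stab_neq0]).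

    The isomorphism sends [a_ g n] to the translate of [block_gen n] by [g].  It
    is injective because it respects multiplication and, up to [e p], the
    nondegenerate forms.  The comultiplication is determined by multiplication
    and form ([tens_form_eq], [comul_form]), so it is respected up to the same
    scalar. *)

Set Implicit Arguments.
Unset Strict Implicit.
Unset Printing Implicit Defensive.

Import GRing.Theory.
Local Open Scope ring_scope.

(** * Tensors *)

Section TensorToolkit.
Variable k : fieldType.
Implicit Types V W U X : vectType k.

Lemma linfunE V W (f : V -> W) : linear f -> linfun f =1 f.
Proof.
move=> lin; pose L : {linear V -> W} := HB.pack f
  (GRing.isLinear.Build k V W *:%R f lin).
exact: (lfunE L).
Qed.

Lemma tensZr V W (v : V) a (w : W) : tens v (a *: w) = a *: tens v w.
Proof. by rewrite linearZ. Qed.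

Lemma tens0l V W (w : W) : tens (0 : V) w = 0.
Proof. by rewrite -(scale0r (0 : V)) tensZl scale0r. Qed.

Lemma tassoc_tens V W U (v : V) (w : W) (u : U) :
  tassoc V W U (tens (tens v w) u) = tens v (tens w u).
Proof.
have lin1 w' (u' : U) : linear (fun v' : V => tens v' (tens w' u')).
  exact: tens_linearl.
have lin2 v' (u' : U) : linear (fun w' : W => tens v' (tens w' u')).
  by move=> a x y; rewrite (tens_linearl u' a x y) linearP.
rewrite /tassoc tlift_tens => [|u'|x].
- by rewrite tlift_tens.
- by move=> a x y; rewrite linearP.
- move=> a u1 u2; rewrite !tliftE scaler_sumr -big_split /=.
  apply: eq_bigr => i _; rewrite scaler_sumr -big_split /=.
  apply: eq_bigr => j _; rewrite linearP (linearP (tens _)).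
  by rewrite scalerDr !scalerA mulrC.
Qed.

Lemma tassoc_inv_tens V W U (v : V) (w : W) (u : U) :
  tassoc_inv V W U (tens v (tens w u)) = tens (tens v w) u.
Proof.
rewrite /tassoc_inv tlift_tens => [|x|v'].
- rewrite tlift_tens => [|u'|w'] // a x y; last by rewrite linearP.
  by rewrite linearP; apply: tens_linearl.
- move=> a v1 v2; rewrite !tliftE scaler_sumr -big_split /=.
  apply: eq_bigr => i _; rewrite scaler_sumr -big_split /=.
  apply: eq_bigr => j _; rewrite (tens_linearl _ a v1 v2).
  by rewrite (tens_linearl _ a) scalerDr !scalerA mulrC.
- by move=> a x y; rewrite linearP.
Qed.

Lemma tunitl_tens V (c : k^o) (v : V) : tunitl V (tens c v) = (c : k) *: v.
Proof.
apply: tlift_tens => [w|c'] a x y; last by rewrite scalerDr !scalerA mulrC.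
by rewrite scalerDl scalerA.
Qed.

Lemma tunitr_tens V (v : V) (c : k^o) : tunitr V (tens v c) = (c : k) *: v.
Proof.
apply: tlift_tens => [c'|w] a x y; first by rewrite scalerDr !scalerA mulrC.
by rewrite scalerDl scalerA.
Qed.

Lemma lfun_tens3P V W U X (f g : 'Hom(tensv (tensv V W) U, X)) :
  (forall v w u, f (tens (tens v w) u) = g (tens (tens v w) u)) -> f = g.
Proof.
move=> fg; apply: lfun_tensP => x u; rewrite (tens_expand x).
rewrite !tens_suml !linear_sum; apply: eq_bigr => i _.
rewrite !tens_suml !linear_sum; apply: eq_bigr => j _.
by rewrite !tensZl !linearZ /= fg.
Qed.

(** The second components in the expansion of [A] along the first basis.
    Through [tens_rows] the tensor [D 1] of a Frobenius algebra is handled as a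
    family of pairs. *)
Definition tens_row V W (A : tensv V W) i : W := \sum_j A i j *: (vbasis {:W})`_j.

Lemma tens_rows V W (A : tensv V W) :
  A = \sum_(i < \dim {:V}) tens (vbasis {:V})`_i (tens_row A i).
Proof.
rewrite {1}(tens_expand A); apply: eq_bigr => i _.
by rewrite linear_sum; apply: eq_bigr => j _; rewrite linearZ.
Qed.

Lemma lfun_unitP V (f g : 'Hom(k^o, V)) : f 1 = g 1 -> f = g.
Proof.
move=> fg; apply/lfunP => c.
have -> : c = (c : k) *: (1 : k^o) by rewrite /GRing.scale /= mulr1.
by rewrite !linearZ /= fg.
Qed.

(** Elements of ['Hom(V, 'Hom(W, U))] carry their bilinearity in their type, so
    that they extend to tensors without side conditions. *)
Definition tuncurry V W U (B : 'Hom(V, 'Hom(W, U))) : 'Hom(tensv V W, U) :=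
  tlift (fun v w => B v w).

Lemma tuncurry_tens V W U (B : 'Hom(V, 'Hom(W, U))) v w :
  tuncurry B (tens v w) = B v w.
Proof.
apply: tlift_tens => [w'|v'] a x y; last by rewrite linearP.
by rewrite linearP /= add_lfunE scale_lfunE.
Qed.

Definition scal_lfun V (v : V) : 'Hom(k^o, V) := linfun (fun c : k^o => (c : k) *: v).

Lemma scal_lfunE V (v : V) c : scal_lfun v c = (c : k) *: v.
Proof.
by rewrite linfunE // => a x y; rewrite scalerDl scalerA.
Qed.

End TensorToolkit.

(** * Gradings and morphisms *)

Section GradingToolkit.
Variables (k : fieldType) (gT : finGroupType).
Implicit Types V W : vectType k.

Lemma yd_comp_id V (Y : ydStruct gT V) g h v :
  v \in yd_gr Y g -> yd_comp Y h v = if h == g then v else 0.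
Proof.
move=> vg; have /directv_sum_independent ind := yd_gr_direct Y.
pose us i := yd_comp Y i v - (if i == g then v else 0).
apply/eqP; rewrite -subr_eq0 -/(us h) (ind us) // => [i _|].
  by rewrite rpredB ?yd_comp_mem //; case: eqP => [->|_] //; apply: mem0v.
by rewrite sumrB yd_comp_sum -big_mkcond big_pred1_eq subrr.
Qed.

Lemma graded_comp V W (Y : ydStruct gT V) (Z : ydStruct gT W) (f : 'Hom(V, W)) :
  (forall g v, v \in yd_gr Y g -> f v \in yd_gr Z g) ->
  forall g v, f (yd_comp Y g v) = yd_comp Z g (f v).
Proof.
move=> grf g v; rewrite -[v in RHS](yd_comp_sum Y) !linear_sum (bigD1 g) //=.
rewrite (yd_comp_id g (grf _ _ (yd_comp_mem Y g v))) eqxx big1 ?addr0 // => h ne.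
by rewrite (yd_comp_id g (grf _ _ (yd_comp_mem Y h v))) eq_sym (negbTE ne).
Qed.

Lemma comp_graded V W (Y : ydStruct gT V) (Z : ydStruct gT W) (f : 'Hom(V, W)) :
  (forall g v, f (yd_comp Y g v) = yd_comp Z g (f v)) ->
  forall g v, v \in yd_gr Y g -> f v \in yd_gr Z g.
Proof.
move=> fc g v vg; have := yd_comp_mem Z g (f v).
by rewrite -fc (yd_comp_id g vg) eqxx.
Qed.

(** Degrees are preserved exactly when component maps are intertwined, a
    condition that passes to the inverse map. *)
Lemma ydmor_inv V W (Y : ydStruct gT V) (Z : ydStruct gT W)
    (f : 'Hom(V, W)) (f' : 'Hom(W, V)) :
  is_ydmor Y Z f -> (f' \o f)%VF = \1%VF -> (f \o f')%VF = \1%VF ->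
  is_ydmor Z Y f'.
Proof.
move=> [fa fg] f'f ff'.
have f'K v : f' (f v) = v by rewrite -[f' _]comp_lfunE f'f id_lfunE.
have fK w : f (f' w) = w by rewrite -[f _]comp_lfunE ff' id_lfunE.
split=> [g w|]; first by rewrite -{1}[w]fK -fa f'K.
apply: comp_graded => g w.
by rewrite -{1}[w]fK -(graded_comp fg) f'K.
Qed.

Lemma ydTens_mor V W (Y : ydStruct gT V) (Z : ydStruct gT W)
    (f : 'Hom(tensv V V, W)) :
  (forall x v w, f (tens (yd_act Y x v) (yd_act Y x w)) = yd_act Z x (f (tens v w))) ->
  (forall g h v w, v \in yd_gr Y g -> w \in yd_gr Y h ->
     f (tens v w) \in yd_gr Z (g * h)%g) ->
  is_ydmor (ydTens Y Y) Z f.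
Proof.
move=> fa fg; split=> [x A|g A] /=.
  transitivity ((f \o tens_act Y Y x)%VF A); first by rewrite comp_lfunE.
  rewrite (_ : (f \o _)%VF = (yd_act Z x \o f)%VF) ?comp_lfunE //.
  by apply: lfun_tensP => v w; rewrite !comp_lfunE tensl_tens fa.
case/memv_sumP => a a_in ->; rewrite linear_sum memv_suml // => h _.
have := a_in h isT; move: (a h) => {a_in}a a_in; rewrite memv_preim.
move: a a_in; apply/subvP/span_subvP => _ /allpairsP[[v w] /= [vA wB ->]].
rewrite -memv_preim -[X in yd_gr Z X](mulKVg h); apply: fg; exact: vbasis_mem.
Qed.

Lemma tens_gr_tens V (Y : ydStruct gT V) g h v w :
  v \in yd_gr Y g -> w \in yd_gr Y h -> tens v w \in yd_gr (ydTens Y Y) (g * h)%g.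
Proof.
move=> vg wh /=; apply: (subvP (sumv_sup g _ (subvv _))) => //.
by rewrite mulKg memv_tensU.
Qed.

Lemma ydBraid_tens V (Y : ydStruct gT V) g v w : v \in yd_gr Y g ->
  ydBraid Y Y (tens v w) = tens (yd_act Y g w) v.
Proof.
move=> vg; rewrite /ydBraid tlift_tens => [|w'|v'].
- rewrite (bigD1 g) //= (yd_comp_id g vg) eqxx big1 ?addr0 // => h ne.
  by rewrite (yd_comp_id h vg) (negbTE ne) linear0.
- move=> a x y; rewrite scaler_sumr -big_split; apply: eq_bigr => h _.
  by rewrite !linearP.
- move=> a x y; rewrite scaler_sumr -big_split; apply: eq_bigr => h _.
  by rewrite linearP (tens_linearl _ a).
Qed.

(** A grading is given here by its component maps: on a quotient these are
    easier to define than the homogeneous subspaces. *)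
Lemma orthogonal_projections_direct V (pr : gT -> 'End(V)) :
  (forall v, \sum_g pr g v = v) ->
  (forall g h v, pr g (pr h v) = if g == h then pr h v else 0) ->
  (\sum_g limg (pr g) = fullv)%VS /\ directv (\sum_g limg (pr g)).
Proof.
move=> pr1 prM; split.
  apply/eqP; rewrite eqEsubv subvf; apply/subvP => v _; rewrite -[v]pr1.
  rewrite memv_suml // => g _.
  by apply: (subvP (sumv_sup g _ (subvv _))); rewrite ?memv_img ?memvf.
apply/directv_sum_independent => a a_in a0 g _.
have prg h : pr g (a h) = if h == g then a h else 0.
  by have /memv_imgP[v _ ->] := a_in h isT; rewrite prM eq_sym.
have := congr1 (pr g) a0; rewrite linear_sum linear0 => <-.
by rewrite (eq_bigr _ (fun h _ => prg h)) -big_mkcond big_pred1_eq.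
Qed.

End GradingToolkit.

(** * The space spanned by the generators *)

Section Generators.
Variables (k : fieldType) (gT : finGroupType) (d : datum k gT).
Local Notation H := (dat_H d).
Local Notation N := (dat_N d).
Local Notation gamma := (dat_gamma d).
Local Notation eps := (dat_eps d).
Local Notation A := (Asp d).
Local Notation a_ := (a_ d).

Lemma datNH n : n \in N -> n \in H.
Proof. exact/subsetP/normal_sub/dat_normal. Qed.

Lemma datJ h n : h \in H -> (h * n * h^-1 \in N)%g = (n \in N).
Proof.
move=> hH; have -> : (h * n * h^-1 = n ^ h^-1)%g by rewrite conjgE invgK mulgA.
by rewrite memJ_norm // groupV (subsetP (normal_norm (dat_normal d))).
Qed.

Lemma eps1 n : n \in N -> eps 1%g n = 1.
Proof.
move=> nN; have := dat_eps_mulH (group1 H) (group1 H) nN.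
rewrite mulg1 mul1g invg1 mulg1 => /eqP.
by rewrite -{1}[eps 1 n]mulr1 (inj_eq (mulfI (dat_eps_neq0 _ _))) // => /eqP.
Qed.

Lemma epsh1 h : h \in H -> eps h 1%g = 1.
Proof.
move=> hH; have := dat_eps_mulN hH (group1 N) (group1 N).
rewrite !mulg1 mulgV -mulrA => /eqP.
rewrite (inj_eq (mulfI (dat_eps_neq0 _ _))) // => /eqP.
by have [-> _] := dat_gamma_norm (group1 N); rewrite mulr1.
Qed.

Lemma gamma1r n : n \in N -> gamma n 1%g = 1.
Proof. by case/dat_gamma_norm. Qed.

Lemma gamma1l n : n \in N -> gamma 1%g n = 1.
Proof. by case/dat_gamma_norm. Qed.

Lemma gammaV n : n \in N -> gamma n^-1%g n = gamma n n^-1%g.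
Proof.
move=> nN; have := dat_gamma_cocycle nN (groupVr nN) nN.
by rewrite mulgV mulVg gamma1l ?gamma1r // mulr1 mul1r.
Qed.

Lemma freeGN_expand (f : freeGN d) :
  f = \sum_(p : gT * [subg N]) (f p : k) *: free_gen d p.1 (sgval p.2).
Proof.
apply/ffunP => -[g n]; rewrite sum_ffunE (bigD1 (g, n)) //= !ffunE sgvalK eqxx.
rewrite /GRing.scale /= mulr1 big1 ?addr0 // => -[x m] ne.
by rewrite !ffunE sgvalK eq_sym (negbTE ne) /GRing.scale /= mulr0.
Qed.

(** The generators span, so linear maps are compared on them. *)
Lemma gen_ext (W : vectType k) (f g : 'Hom(A, W)) :
  (forall x n, n \in N -> f (a_ x n) = g (a_ x n)) -> f = g.
Proof.
move=> fg; apply/lfunP => v; have [w <-] := quot_pi_surj v.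
rewrite (freeGN_expand w) !linear_sum; apply: eq_bigr => p _.
by rewrite !linearZ /= -/(Defs.a_ d p.1 (sgval p.2)) fg ?subgP.
Qed.

Lemma gen_ext2 (W : vectType k) (f g : 'Hom(tensv A A, W)) :
  (forall x n y m, n \in N -> m \in N ->
     f (tens (a_ x n) (a_ y m)) = g (tens (a_ x n) (a_ y m))) -> f = g.
Proof.
move=> fg; apply: lfun_tensP => v w.
pose T (f : 'Hom(tensv A A, W)) : 'Hom(A, 'Hom(A, W)) :=
  linfun (fun v => linfun (fun w => f (tens v w))).
have TE f' v' w' : T f' v' w' = f' (tens v' w').
  have lin1 u : linear (fun w => f' (tens u w)).
    by move=> a x y; rewrite !linearP.
  have lin2 : linear (fun v => linfun (fun w => f' (tens v w))).
    move=> a x y; apply/lfunP => u; rewrite add_lfunE scale_lfunE.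
    by rewrite !(linfunE (lin1 _)) (tens_linearl u a) linearP.
  by rewrite (linfunE lin2) (linfunE (lin1 _)).
suff ETg : T f = T g by rewrite -!TE ETg.
by apply: gen_ext => x n nN; apply: gen_ext => y m mN; rewrite !TE fg.
Qed.

(** The universal property of the quotient.  A class is represented by its
    [vsval] in the chosen complement of the relations; by [gen_liftE] the value on
    a generator does not depend on this choice when [F] satisfies the relations. *)
Definition gen_lift (W : vectType k) (F : gT -> gT -> W) : 'Hom(A, W) :=
  linfun (fun x : A =>
    \sum_(p : gT * [subg N]) ((vsval x : freeGN d) p : k) *: F p.1 (sgval p.2)).

Lemma gen_liftE (W : vectType k) (F : gT -> gT -> W) g n :
  (forall g h n, h \in H -> n \in N ->
     F (g * h)%g n = eps h n *: F g (h * n * h^-1)%g) ->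
  n \in N -> gen_lift F (a_ g n) = F g n.
Proof.
move=> Frel nN.
pose L0 (v : freeGN d) : W :=
  \sum_(p : gT * [subg N]) (v p : k) *: F p.1 (sgval p.2).
have linL0 : linear L0.
  move=> a x y; rewrite scaler_sumr -big_split; apply: eq_bigr => p _.
  by rewrite !ffunE scalerDl scalerA.
have [L LE] : exists L : 'Hom(freeGN d, W), L =1 L0.
  by exists (linfun L0); apply: linfunE.
have linA : linear (fun x : A => L0 (vsval x)) by move=> a x y; apply: linL0.
have Lgen x m : m \in N -> L (free_gen d x m) = F x m.
  move=> mN; rewrite LE /L0 (bigD1 (x, subg N m)) //= !ffunE eqxx scale1r.
  rewrite subgK // big1 ?addr0 // => p ne; rewrite ffunE (negbTE ne).
  exact: scale0r.
have Lker v : v \in rel_space d -> L v = 0.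
  move=> vR; apply/eqP; rewrite -memv_ker; move: v vR; apply/subvP/span_subvP => v.
  case/imageP => -[[x h] m]; rewrite inE /= => /andP[hH mN] ->.
  by rewrite memv_ker linearB linearZ /= !Lgen ?datJ // Frel // subrr.
rewrite /gen_lift (linfunE linA) -LE -[RHS]Lgen //.
suff vR : vsval (a_ g n) - free_gen d g n \in rel_space d.
  by have := Lker _ vR; rewrite linearB => /eqP; rewrite subr_eq0 => /eqP.
rewrite -quot_pi_eq0 linearB /= subr_eq0; apply/eqP.
rewrite /Defs.a_; set x := quot_pi _ _.
rewrite comp_lfunE lfunE /= daddv_pi_id ?capv_complC ?subvsP //.
exact: vsvalK.
Qed.

(** Every computation with generators over one coset is thereby moved to a
    common representative, where only the twisted group algebra of [N] is left. *)
Lemma gen_move g x n : (x^-1 * g \in H)%g -> n \in N ->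
  a_ g n = eps (x^-1 * g)%g n *: a_ x (x^-1 * g * n * (x^-1 * g)^-1)%g.
Proof. by move=> tH nN; rewrite -a_rel // mulKVg. Qed.

Lemma gen_coset1 g x : (x^-1 * g \in H)%g -> a_ g 1%g = a_ x 1%g.
Proof. by move=> tH; rewrite (gen_move tH) // mulg1 mulgV epsh1 ?scale1r. Qed.

End Generators.

(** * The algebra structure on the generators *)

Section AlgebraStructure.
Variables (k : fieldType) (gT : finGroupType) (d : datum k gT).
Local Notation H := (dat_H d).
Local Notation N := (dat_N d).
Local Notation gamma := (dat_gamma d).
Local Notation eps := (dat_eps d).
Local Notation A := (Asp d).
Local Notation a_ := (a_ d).

Lemma gen_ind (P : A -> Prop) :
  P 0 -> (forall c v w, P v -> P w -> P (c *: v + w)) ->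
  (forall g n, n \in N -> P (a_ g n)) -> forall v, P v.
Proof.
move=> P0 PD Pa v; have [w <-] := quot_pi_surj v.
rewrite (freeGN_expand w) linear_sum; elim/big_rec: _ => // p x _ Px.
by rewrite linearZ /=; apply: PD => //; apply: Pa; apply: subgP.
Qed.

Definition gen_act x : 'End(A) := gen_lift d (fun g n => a_ (x * g)%g n).

Lemma gen_actE x g n : n \in N -> gen_act x (a_ g n) = a_ (x * g)%g n.
Proof.
by move=> nN; apply: gen_liftE => // g' h m hH mN; rewrite mulgA a_rel.
Qed.

Definition gen_proj x : 'End(A) :=
  gen_lift d (fun g n => if (g * n * g^-1 == x)%g then a_ g n else 0).

Lemma gen_projE x g n : n \in N ->
  gen_proj x (a_ g n) = if (g * n * g^-1 == x)%g then a_ g n else 0.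
Proof.
move=> nN; apply: gen_liftE => // g' h m hH mN; rewrite a_rel // !gnorm.
by case: eqP => // _; rewrite scaler0.
Qed.

(** Moved to the representative [x], the generator [a_ g n] becomes a multiple of
    [a_ x (t * n * t^-1)]. *)
Definition gen_mul_val g n x m : A :=
  let t := (x^-1 * g)%g in
  if t \in H then
    (gamma (t * n * t^-1)%g m * eps t n) *: a_ x (t * n * t^-1 * m)%g
  else 0.

Lemma gen_mul_val_rell g h n x m : h \in H -> n \in N ->
  gen_mul_val (g * h)%g n x m = eps h n *: gen_mul_val g (h * n * h^-1)%g x m.
Proof.
move=> hH nN; rewrite /gen_mul_val mulgA groupMr //; case: ifP => [tH|_].
  by rewrite dat_eps_mulH // scalerA !gnorm; congr (_ *: _); ring.
by rewrite scaler0.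
Qed.

(** With [t = h s], both sides are compared by splitting [eps t] and by pushing
    [eps h] through the product of [s n s^-1] and [m]. *)
Lemma gen_mul_val_relr g n x h m : h \in H -> n \in N -> m \in N ->
  gen_mul_val g n (x * h)%g m = eps h m *: gen_mul_val g n x (h * m * h^-1)%g.
Proof.
move=> hH nN mN; rewrite /gen_mul_val /=; set s := ((x * h)^-1 * g)%g.
have -> : (x^-1 * g = h * s)%g by rewrite /s !gnorm.
rewrite (groupMl s hH); case: ifP => [sH|_]; last by rewrite scaler0.
have qN : (s * n * s^-1 \in N)%g by rewrite datJ.
rewrite a_rel ?(groupM qN mN) // !scalerA (dat_eps_mulH hH sH nN).
have -> : (h * s * n * (h * s)^-1 = h * (s * n * s^-1) * h^-1)%g by rewrite !gnorm.
set q := (s * n * s^-1)%g in qN *.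
have -> : (h * (q * m) * h^-1 = h * q * h^-1 * (h * m * h^-1))%g by rewrite !gnorm.
congr (_ *: _); rewrite mulrAC [gamma q m * _]mulrC dat_eps_mulN //; ring.
Qed.

Definition gen_mul : 'Hom(A, 'Hom(A, A)) :=
  gen_lift d (fun g n => gen_lift d (fun x m => gen_mul_val g n x m)).

Local Notation "v ** w" := (gen_mul v w) (at level 40, left associativity).

Lemma gen_mulE g n x m : n \in N -> m \in N ->
  a_ g n ** a_ x m = gen_mul_val g n x m.
Proof.
move=> nN mN; rewrite gen_liftE // => [|g' h n' hH n'N].
  by rewrite gen_liftE // => x' h m' hH m'N; apply: gen_mul_val_relr.
apply: gen_ext => x' m' m'N; rewrite scale_lfunE !gen_liftE ?gen_mul_val_rell //.
  by move=> x2 h2 m2 h2H m2N; apply: gen_mul_val_relr => //; rewrite datJ.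
by move=> x2 h2 m2 h2H m2N; apply: gen_mul_val_relr.
Qed.

Lemma gen_mul_same x n m : n \in N -> m \in N ->
  a_ x n ** a_ x m = gamma n m *: a_ x (n * m)%g.
Proof.
by move=> nN mN; rewrite gen_mulE // /gen_mul_val mulVg group1 !gnorm eps1 // mulr1.
Qed.

Lemma gen_mul_diff g x n m : (x^-1 * g \notin H)%g -> n \in N -> m \in N ->
  a_ g n ** a_ x m = 0.
Proof.
by move=> tH nN mN; rewrite gen_mulE // /gen_mul_val (negbTE tH).
Qed.

Lemma coset_sym g x : ((g^-1 * x \in H) = (x^-1 * g \in H))%g.
Proof. by rewrite -groupV !gnorm. Qed.

Lemma gen_mulDl c u v w : (c *: u + v) ** w = c *: (u ** w) + v ** w.
Proof. by rewrite linearP /= add_lfunE scale_lfunE. Qed.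

Lemma gen_mulZl c u w : (c *: u) ** w = c *: (u ** w).
Proof. by rewrite linearZ /= scale_lfunE. Qed.

Lemma gen_mul0l w : 0 ** w = 0.
Proof. by rewrite linear0 zero_lfunE. Qed.

(** A product of generators over different cosets vanishes however it is
    bracketed; over one coset, associativity is the cocycle identity. *)
Lemma gen_mulA u v w : (u ** v) ** w = u ** (v ** w).
Proof.
move: u v w; elim/gen_ind => [v w|c u1 u2 IH1 IH2 v w|g n nN].
- by rewrite !gen_mul0l.
- by rewrite !gen_mulDl IH1 IH2.
elim/gen_ind => [w|c v1 v2 IH1 IH2 w|x m mN].
- by rewrite !(linear0, gen_mul0l).
- by rewrite linearP !gen_mulDl linearP /= IH1 IH2.
elim/gen_ind => [|c v1 v2 IH1 IH2|y l lN]; first by rewrite !linear0.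
  by rewrite !linearP /= IH1 IH2.
have [gx|gx] := boolP (x^-1 * g \in H)%g; last first.
  rewrite gen_mul_diff // gen_mul0l.
  have [xy|xy] := boolP (y^-1 * x \in H)%g; last by rewrite gen_mul_diff // linear0.
  rewrite coset_sym in xy; rewrite (gen_move xy lN) linearZ /= gen_mul_same ?datJ //.
  by rewrite !linearZ /= gen_mul_diff ?(groupM mN) ?datJ // !scaler0.
have [xy|xy] := boolP (y^-1 * x \in H)%g; last first.
  rewrite [a_ x m ** _]gen_mul_diff // linear0 (gen_move gx nN) gen_mulZl.
  have n'N : (x^-1 * g * n * (x^-1 * g)^-1 \in N)%g by rewrite datJ.
  by rewrite gen_mul_same // !gen_mulZl gen_mul_diff ?(groupM n'N) // !scaler0.
have gy : (y^-1 * g \in H)%g by have := groupM xy gx; rewrite !gnorm.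
rewrite (gen_move gy nN) (gen_move xy mN) !(gen_mulZl, linearZ) /=.
have := datJ n gy; rewrite nN; set n' := (_ * _)%g => n'N.
have := datJ m xy; rewrite mN; set m' := (_ * _)%g => m'N.
move: n' m' n'N m'N => n' m' n'N m'N; congr (_ *: (_ *: _)).
rewrite gen_mul_same // gen_mulZl [a_ y m' ** _]gen_mul_same // linearZ /=.
rewrite !gen_mul_same ?(groupM n'N) ?(groupM m'N) // !scalerA mulgA.
by rewrite dat_gamma_cocycle // mulrC.
Qed.

Lemma gen_act_mul x v w : gen_act x (v ** w) = gen_act x v ** gen_act x w.
Proof.
move: v w; elim/gen_ind => [w|c v1 v2 IH1 IH2 w|g n nN].
- by rewrite !(linear0, gen_mul0l).
- by rewrite gen_mulDl !linearP /= IH1 IH2 add_lfunE scale_lfunE.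
elim/gen_ind => [|c v1 v2 IH1 IH2|y m mN]; first by rewrite !linear0.
  by rewrite !linearP /= IH1 IH2.
rewrite !gen_actE // !gen_mulE // /gen_mul_val.
have -> : ((x * y)^-1 * (x * g) = y^-1 * g)%g by rewrite !gnorm.
case: ifP => [tH|_]; last by rewrite linear0.
by rewrite linearZ /= gen_actE // groupM // datJ.
Qed.

Lemma gen_act1 : gen_act 1%g = \1%VF.
Proof. by apply: gen_ext => g n nN; rewrite gen_actE // mul1g id_lfunE. Qed.

Lemma gen_actM x y : gen_act (x * y)%g = (gen_act x \o gen_act y)%VF.
Proof. by apply: gen_ext => g n nN; rewrite comp_lfunE !gen_actE // mulgA. Qed.

Lemma gen_act_proj x g v :
  gen_act x (gen_proj g v) = gen_proj (x * g * x^-1)%g (gen_act x v).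
Proof.
elim/gen_ind: v => [|c v w IH1 IH2|y n nN]; first by rewrite !linear0.
  by rewrite !linearP /= IH1 IH2.
rewrite gen_projE // gen_actE // gen_projE // !gnorm.
rewrite (inj_eq (mulIg _)) -!mulgA (inj_eq (mulgI x)).
by case: ifP => _; rewrite ?linear0 ?gen_actE.
Qed.

Lemma gen_proj_sum v : \sum_g gen_proj g v = v.
Proof.
elim/gen_ind: v => [|c v w IH1 IH2|y n nN].
- by apply: big1 => g _; rewrite linear0.
- rewrite -[in RHS]IH1 -[in RHS]IH2 scaler_sumr -big_split.
  by apply: eq_bigr => g _; rewrite linearP.
rewrite (eq_bigr _ (fun g _ => gen_projE g y nN)).
by rewrite -big_mkcond (big_pred1 (y * n * y^-1)%g) // => g; rewrite eq_sym.
Qed.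

Lemma gen_projM g h v :
  gen_proj g (gen_proj h v) = if g == h then gen_proj h v else 0.
Proof.
elim/gen_ind: v => [|c v w IH1 IH2|y n nN].
- by rewrite !linear0; case: ifP.
- by rewrite !linearP /= IH1 IH2; case: ifP => _ //; rewrite scaler0 addr0.
rewrite gen_projE //; case: (_ =P h) => [yh|_]; last by rewrite linear0; case: ifP.
by rewrite gen_projE // yh eq_sym.
Qed.

Lemma gen_act_gr x g v : v \in limg (gen_proj g) ->
  gen_act x v \in limg (gen_proj (x * g * x^-1)%g).
Proof. by case/memv_imgP => w _ ->; rewrite gen_act_proj memv_img ?memvf. Qed.

Definition gen_yd : ydStruct gT A := {|
  yd_act := gen_act;
  yd_gr := fun g => limg (gen_proj g);
  yd_act1 := gen_act1;
  yd_actM := gen_actM;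
  yd_gr_full := (orthogonal_projections_direct gen_proj_sum gen_projM).1;
  yd_gr_direct := (orthogonal_projections_direct gen_proj_sum gen_projM).2;
  yd_act_gr := gen_act_gr |}.

Lemma gen_gr g n : n \in N -> a_ g n \in limg (gen_proj (g * n * g^-1)%g).
Proof.
move=> nN; suff {1}-> : a_ g n = gen_proj (g * n * g^-1)%g (a_ g n).
  by rewrite memv_img ?memvf.
by rewrite gen_projE // eqxx.
Qed.

Definition gen_mulm : 'Hom(tensv A A, A) := tuncurry gen_mul.

Lemma gen_mulmE v w : gen_mulm (tens v w) = v ** w.
Proof. exact: tuncurry_tens. Qed.

Lemma gen_mul_proj g h v w :
  gen_proj g v ** gen_proj h w = gen_proj (g * h)%g (gen_proj g v ** gen_proj h w).
Proof.
move: v w; elim/gen_ind => [w|c v1 v2 IH1 IH2 w|x n nN].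
- by rewrite linear0 gen_mul0l linear0.
- by rewrite [gen_proj g _]linearP gen_mulDl {1}IH1 {1}IH2 -linearP.
elim/gen_ind => [|c v1 v2 IH1 IH2|y m mN]; first by rewrite !linear0.
  by rewrite [gen_proj h _]linearP linearP /= {1}IH1 {1}IH2 -linearP.
rewrite !gen_projE //; case: (_ =P g) => [<-|_]; last by rewrite gen_mul0l linear0.
case: (_ =P h) => [<-|_]; last by rewrite !linear0.
rewrite gen_mulE // /gen_mul_val; case: ifP => [tH|_]; last by rewrite linear0.
have n'N : (y^-1 * x * n * (y^-1 * x)^-1 \in N)%g by rewrite datJ.
by rewrite linearZ /= gen_projE ?(groupM n'N) // !gnorm eqxx.
Qed.

Lemma gen_mul_mor : is_ydmor (ydTens gen_yd gen_yd) gen_yd gen_mulm.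
Proof.
apply: ydTens_mor => [x v w|g h _ _ /memv_imgP[v _ ->] /memv_imgP[w _ ->]].
  by rewrite !gen_mulmE gen_act_mul.
by rewrite gen_mulmE gen_mul_proj memv_img ?memvf.
Qed.

(** Both sides vanish unless the generators sit over the same coset, where the
    relation is the compatibility between [eps] on [N] and [gamma]. *)
Lemma gen_commutative : is_commutative gen_yd gen_mulm.
Proof.
apply: gen_ext2 => g n x m nN mN; rewrite comp_lfunE.
rewrite (@ydBraid_tens _ _ _ gen_yd _ _ _ (gen_gr g nN)) !gen_mulmE.
have [tH|tH] := boolP (g^-1 * x \in H)%g; last first.
  rewrite gen_mul_diff -1?coset_sym // /= gen_actE // gen_mul_diff //.
  by rewrite !gnorm -mulgA (groupMl _ (datNH nN)).
rewrite (gen_move tH mN); set m' := (_ * m * _)%g.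
have m'N : m' \in N by rewrite datJ.
rewrite !linearZ /= scale_lfunE gen_actE // gen_mul_same //; congr (_ *: _).
have -> : (g * n * g^-1 * g = g * n)%g by rewrite !gnorm.
have nH := datNH nN.
rewrite a_rel // gen_mulZl gen_mul_same ?datJ // scalerA.
by rewrite -dat_eps_comm // !gnorm.
Qed.

End AlgebraStructure.

(** * Coset decompositions *)

Section CosetDecomposition.
Variables (gT : finGroupType) (H : {group gT}).

Lemma lcoset_eqE g x : (g *: H == x *: H)%g = (x^-1 * g \in H)%g.
Proof. by rewrite -mem_lcoset; apply/eqP/lcoset_eqP. Qed.

Lemma coset_decomposition_card (I : finType) (r : I -> gT) :
  (forall x : gT, exists! i : I, x \in (r i *: H)%g) -> #|I| = #|[set: gT] : H|%g.
Proof.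
move=> rP; rewrite -card_lcosets -(card_imset (f := fun i => (r i *: H)%g) predT).
  apply: eq_card => C; apply/imsetP/lcosetsP => -[].
    by move=> i _ ->; exists (r i); rewrite ?inE.
  move=> x _ ->; have [i [xi _]] := rP x; exists i; rewrite ?inE //.
  by apply/lcoset_eqP.
move=> i j ij; have [l [_ uni]] := rP (r i).
by rewrite -(uni i) ?lcoset_refl // -(uni j) // -ij lcoset_refl.
Qed.

Lemma coset_decomposition_exists : exists (I : finType) (r : I -> gT),
  forall x : gT, exists! i : I, x \in (r i *: H)%g.
Proof.
pose I : finType := {C : {set gT} | C \in lcosets H [set: gT]}.
have rE (C : I) : (repr (val C) *: H)%g = val C.
  case: C => _ /= /lcosetsP[y _ ->]; apply: lcoset_eqP.
  exact: (mem_repr y (lcoset_refl _ _)).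
exists I, (fun C : I => repr (val C)) => x.
have Cx : (x *: H)%g \in lcosets H [set: gT] by apply/lcosetsP; exists x; rewrite ?inE.
exists (Sub (x *: H)%g Cx : I); split=> [|C']; first by rewrite rE SubK lcoset_refl.
by rewrite rE => xC; apply: val_inj; rewrite /= -(rE C'); apply: lcoset_eqP; rewrite rE.
Qed.

End CosetDecomposition.

(** * The unit and connectedness *)

Section UnitCounit.
Variables (k : fieldType) (gT : finGroupType) (d : datum k gT).
Local Notation H := (dat_H d).
Local Notation N := (dat_N d).
Local Notation gamma := (dat_gamma d).
Local Notation eps := (dat_eps d).
Local Notation A := (Asp d).
Local Notation a_ := (a_ d).
Local Notation Y := (gen_yd d).
Local Notation "v ** w" := (gen_mul d v w) (at level 40, left associativity).

Definition gen_counit : 'Hom(A, k^o) :=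
  gen_lift d (fun _ n => ((n == 1%g)%:R : k^o)).

Lemma gen_counitE g n : n \in N -> gen_counit (a_ g n) = (n == 1%g)%:R.
Proof.
move=> nN; apply: gen_liftE => // _ h m hH mN.
have -> : (h * m * h^-1 == 1 = (m == 1))%g.
  by rewrite -{1}(mulgV h) (inj_eq (mulIg _)) -{2}[h]mulg1 (inj_eq (mulgI h)).
by case: eqP => [->|_]; rewrite ?scaler0 // epsh1 // scale1r.
Qed.

Lemma gen_counit_act x v : gen_counit (gen_act d x v) = gen_counit v.
Proof.
elim/gen_ind: v => [|c v w IH1 IH2|g n nN]; first by rewrite !linear0.
  by rewrite !linearP /= IH1 IH2.
by rewrite gen_actE // !gen_counitE.
Qed.

Lemma gen_counit_mor : is_ydmor Y (@ydUnit k gT) gen_counit.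
Proof.
split=> [g v|g _ /memv_imgP[v _ ->]] /=.
  by rewrite gen_counit_act id_lfunE.
elim/gen_ind: v => [|c v w IH1 IH2|x n nN]; first by rewrite !linear0 mem0v.
  by rewrite !linearP /= rpredD ?rpredZ.
rewrite gen_projE //; case: eqP => [<-|_]; last by rewrite linear0 mem0v.
rewrite gen_counitE // /unit_gr; case: (n =P 1%g) => [->|_]; last by rewrite mem0v.
by rewrite mulg1 mulgV eqxx memvf.
Qed.

(** The trivial degree part is spanned by the [a_ x 1], which are equal to
    [a_ g 1] or orthogonal to it; the counit of [a_ g 1] is [1], so it reads off
    the scalar. *)
Lemma gen_proj1_mul v g :
  gen_proj d 1%g v ** a_ g 1%g =
    gen_counit (gen_proj d 1%g v ** a_ g 1%g) *: a_ g 1%g.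
Proof.
elim/gen_ind: v => [|c v w IH1 IH2|x n nN].
- by rewrite linear0 gen_mul0l linear0 scale0r.
- rewrite [gen_proj d 1%g _]linearP gen_mulDl {1}IH1 {1}IH2 linearP /=.
  by rewrite scalerDl scalerA.
rewrite gen_projE //; case: eqP => [xn|_]; last first.
  by rewrite gen_mul0l linear0 scale0r.
have n1 : n = 1%g.
  by apply: (mulgI x); apply: (mulIg x^-1%g); rewrite xn mulg1 mulgV.
rewrite {n nN xn}n1; have [tH|tH] := boolP (g^-1 * x \in H)%g; last first.
  by rewrite gen_mul_diff // linear0 scale0r.
rewrite (gen_coset1 tH) gen_mul_same // gamma1r // scale1r mulg1.
by rewrite gen_counitE // eqxx scale1r.
Qed.

Section Unit.
Variables (I : finType) (r : I -> gT).
Hypothesis rP : is_coset_decomposition d r.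

Definition gen_one : A := \sum_i a_ (r i) 1%g.

Lemma gen_sumE (g : gT) (x : A) :
  \sum_i (if (g^-1 * r i \in H)%g then x else 0) = x.
Proof.
have [i0 [gi0 uni]] := rP g; rewrite (bigD1 i0) //= coset_sym -mem_lcoset gi0.
rewrite big1 ?addr0 // => i ne; case: ifP => // gi; case/eqP: ne.
by rewrite -(uni i) // mem_lcoset -coset_sym.
Qed.

Lemma gen_mul1l v : gen_one ** v = v.
Proof.
elim/gen_ind: v => [|c v w IH1 IH2|g n nN]; first by rewrite linear0.
  by rewrite linearP /= IH1 IH2.
rewrite -[RHS](gen_sumE g) linear_sum sum_lfunE /=; apply: eq_bigr => i _.
case: ifP => [tH|/negbT tH]; last by rewrite gen_mul_diff.
by rewrite (gen_coset1 tH) gen_mul_same // gamma1l // scale1r mul1g.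
Qed.

Lemma gen_mul1r v : v ** gen_one = v.
Proof.
elim/gen_ind: v => [|c v w IH1 IH2|g n nN]; first by rewrite gen_mul0l.
  by rewrite gen_mulDl IH1 IH2.
rewrite -[RHS](gen_sumE g) linear_sum /=; apply: eq_bigr => i _.
case: ifP => [tH|tH]; last by rewrite gen_mul_diff // -coset_sym tH.
by rewrite (gen_coset1 tH) gen_mul_same // gamma1r // scale1r mulg1.
Qed.

(** A translate of the unit is again a unit, and units are unique. *)
Lemma gen_act_one x : gen_act d x gen_one = gen_one.
Proof.
have xK v : gen_act d x (gen_act d x^-1 v) = v.
  by rewrite -comp_lfunE -gen_actM mulgV gen_act1 id_lfunE.
by rewrite -[LHS]gen_mul1r -{2}(xK gen_one) -gen_act_mul gen_mul1l xK.
Qed.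

Lemma gen_one_gr : gen_one \in limg (gen_proj d 1%g).
Proof.
apply: memv_suml => i _; have := gen_gr (r i) (group1 (dat_N d)).
by rewrite mulg1 mulgV.
Qed.

Definition gen_unit : 'Hom(k^o, A) := scal_lfun gen_one.

Lemma gen_unit_mor : is_ydmor (@ydUnit k gT) Y gen_unit.
Proof.
split=> [g v|g v] /=; first by rewrite !scal_lfunE linearZ /= gen_act_one id_lfunE.
rewrite /unit_gr; case: eqP => [-> _|_].
  by rewrite scal_lfunE rpredZ ?gen_one_gr.
by rewrite memv0 => /eqP->; rewrite linear0 mem0v.
Qed.

Lemma gen_algebra : is_yd_algebra Y (gen_mulm d) gen_unit.
Proof.
split; [exact: gen_mul_mor|exact: gen_unit_mor|apply: lfun_tens3P|..].
- move=> u v w; rewrite !comp_lfunE tassoc_tens !tensl_tens !gen_mulmE.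
  by rewrite !id_lfunE gen_mulA.
- apply: lfun_tensP => c v; rewrite comp_lfunE tensl_tens gen_mulmE tunitl_tens.
  by rewrite scal_lfunE gen_mulZl gen_mul1l id_lfunE.
apply: lfun_tensP => v c; rewrite comp_lfunE tensl_tens gen_mulmE tunitr_tens.
by rewrite scal_lfunE linearZ /= gen_mul1r id_lfunE.
Qed.

Lemma gen_counit_one : gen_counit gen_one = #|[set: gT] : H|%g%:R.
Proof.
rewrite linear_sum (eq_bigr (fun=> 1)) => [|i _]; last by rewrite /= gen_counitE ?eqxx.
by rewrite sumr_const -(coset_decomposition_card rP).
Qed.

Lemma gen_one_neq0 : gen_one != 0.
Proof.
apply/eqP => one0; have := dat_indexH d.
by rewrite -gen_counit_one one0 linear0 eqxx.
Qed.

(** An invariant [v] of trivial degree acts on the idempotent [a_ g 1] by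
    [gen_counit (v ** a_ g 1)], which is independent of [g] by invariance. *)
Lemma gen_invariant v : v \in limg (gen_proj d 1%g) ->
  (forall x, gen_act d x v = v) ->
  v = gen_counit (v ** a_ 1%g 1%g) *: gen_one.
Proof.
move=> /memv_imgP[w _ ->] inv; rewrite -{1}[gen_proj d _ w]gen_mul1r.
rewrite !linear_sum /=; apply: eq_bigr => i _; rewrite gen_proj1_mul.
rewrite -{1}[r i]mulg1 -[in LHS](inv (r i)) -gen_actE // -gen_act_mul.
by rewrite gen_counit_act.
Qed.

Lemma gen_connected : is_connected Y.
Proof.
exists <[gen_unit]>%VS => [f|]; last first.
  rewrite dim_vline; suff -> : gen_unit != 0 by [].
  apply: contra gen_one_neq0 => /eqP u0.
  by rewrite -[gen_one]scale1r -[_ *: _](scal_lfunE gen_one 1) -/gen_unit u0 lfunE.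
split=> [/vlineP[c ->]|[fa fg]].
  have [ua ug] := gen_unit_mor; split=> [g v|g v vg].
    by rewrite !scale_lfunE ua linearZ.
  by rewrite scale_lfunE rpredZ ?ug.
apply/vlineP; exists (gen_counit (f 1 ** a_ 1%g 1%g)); apply: lfun_unitP.
rewrite scale_lfunE scal_lfunE scale1r; apply: gen_invariant.
  by apply: fg; rewrite /= /unit_gr eqxx memvf.
by move=> x; rewrite -[LHS]fa /= id_lfunE.
Qed.

End Unit.
End UnitCounit.

(** * The Frobenius structure on the generators *)

Section FrobeniusStructure.
Variables (k : fieldType) (gT : finGroupType) (d : datum k gT).
Local Notation H := (dat_H d).
Local Notation N := (dat_N d).
Local Notation gamma := (dat_gamma d).
Local Notation eps := (dat_eps d).
Local Notation A := (Asp d).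
Local Notation a_ := (a_ d).
Local Notation Y := (gen_yd d).
Local Notation "v ** w" := (gen_mul d v w) (at level 40, left associativity).

Definition gen_comul_coef n m := gamma m^-1%g n / gamma m^-1%g m.

Local Notation coef := gen_comul_coef.

(** This makes the comultiplication compatible with the relations.  It follows
    from the law for [eps h] on products at [(m^-1, n)] and at [(m^-1, m)], the
    second product being [1]. *)
Lemma comul_coefJ h n m : h \in H -> n \in N -> m \in N ->
  coef n m * (eps h m * eps h (m^-1 * n)%g) =
  eps h n * coef (h * n * h^-1)%g (h * m * h^-1)%g.
Proof.
move=> hH nN mN; have m'N := groupVr mN.
have E1 := dat_eps_mulN hH m'N nN; have := dat_eps_mulN hH m'N mN.
rewrite mulVg epsh1 // mul1r => E2.
have -> : coef (h * n * h^-1)%g (h * m * h^-1)%g =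
    gamma (h * m^-1 * h^-1)%g (h * n * h^-1)%g /
    gamma (h * m^-1 * h^-1)%g (h * m * h^-1)%g.
  by rewrite /gen_comul_coef !gnorm.
have ne1 := dat_gamma_neq0 m'N mN.
have ne2 : gamma (h * m^-1 * h^-1)%g (h * m * h^-1)%g != 0.
  by rewrite dat_gamma_neq0 ?datJ.
rewrite /gen_comul_coef; move: E1 ne1; rewrite E2 !mulf_eq0 !negb_or.
move=> E1 /andP[/andP[ne3 ne4] _]; rewrite mulrACA.
apply: (mulIf ne2); rewrite -[RHS]mulrA divfK //.
have -> : gamma m^-1%g n * eps h m *
   ((eps h m^-1%g * eps h m * gamma (h * m^-1 * h^-1)%g (h * m * h^-1)%g)^-1 *
     eps h (m^-1 * n)%g) * gamma (h * m^-1 * h^-1)%g (h * m * h^-1)%g =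
   (eps h (m^-1 * n)%g * gamma m^-1%g n) / eps h m^-1%g.
  by field; rewrite ne2 ne3 ne4.
by rewrite E1; field.
Qed.

Definition gen_comul_val g n : tensv A A :=
  \sum_(m in N) coef n m *: tens (a_ g m) (a_ g (m^-1 * n)%g).

Lemma gen_comul_val_rel g h n : h \in H -> n \in N ->
  gen_comul_val (g * h)%g n = eps h n *: gen_comul_val g (h * n * h^-1)%g.
Proof.
move=> hH nN; rewrite /gen_comul_val scaler_sumr.
rewrite [RHS](reindex_inj (conjg_inj h^-1%g)) /=.
have cE m : (m ^ h^-1 = h * m * h^-1)%g by rewrite conjgE invgK mulgA.
apply: eq_big => [m|m mN]; rewrite cE ?datJ //.
have mnN : (m^-1 * n \in N)%g by rewrite groupM ?groupV.
rewrite !a_rel // tensZl tensZr !scalerA comul_coefJ //.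
by congr (_ *: tens _ (a_ _ _)); rewrite !gnorm.
Qed.

Definition gen_comul : 'Hom(A, tensv A A) := gen_lift d gen_comul_val.

Lemma gen_comulE g n : n \in N -> gen_comul (a_ g n) =
  \sum_(m in N) coef n m *: tens (a_ g m) (a_ g (m^-1 * n)%g).
Proof. by move=> nN; apply: gen_liftE => // *; apply: gen_comul_val_rel. Qed.

Lemma gen_comul_mor : is_ydmor Y (ydTens Y Y) gen_comul.
Proof.
split=> [x v|g _ /memv_imgP[v _ ->]].
  rewrite /= -[LHS]comp_lfunE -[RHS]comp_lfunE; congr (fun_of_lfun _ v).
  apply: gen_ext => g n nN; rewrite !comp_lfunE gen_actE // !gen_comulE //.
  rewrite linear_sum; apply: eq_bigr => m mN.
  by rewrite linearZ /= tensl_tens !gen_actE ?groupM ?groupV.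
elim/gen_ind: v => [|c v w IH1 IH2|x n nN]; first by rewrite !linear0 mem0v.
  by rewrite !linearP /= rpredD ?rpredZ.
rewrite gen_projE //; case: eqP => [<-|_]; last by rewrite linear0 mem0v.
rewrite gen_comulE // memv_suml // => m mN; rewrite rpredZ //.
have -> : (x * n * x^-1 = (x * m * x^-1) * (x * (m^-1 * n) * x^-1))%g.
  by rewrite !gnorm.
by apply: tens_gr_tens; apply: gen_gr; rewrite ?groupM ?groupV.
Qed.

(** Both sides expand along the tensors of [a_ g l], [a_ g t] and
    [a_ g (t^-1 l^-1 n)].  The coefficients match by the cocycle identity for
    [(t^-1, l^-1, n)] divided by the one for [(t^-1, l^-1, l t)]. *)
Lemma gen_coassoc :
  (tassoc A A A \o tensl gen_comul \1 \o gen_comul =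
   tensl \1 gen_comul \o gen_comul)%VF.
Proof.
apply: gen_ext => g n nN; rewrite !comp_lfunE gen_comulE // !linear_sum.
under eq_bigr => m mN.
  rewrite !linearZ /= tensl_tens gen_comulE // id_lfunE tens_suml.
  rewrite linear_sum scaler_sumr.
  under eq_bigr => l lN do rewrite tensZl linearZ /= tassoc_tens scalerA.
  over.
under [RHS]eq_bigr => m mN.
  rewrite linearZ /= tensl_tens gen_comulE ?groupM ?groupV // id_lfunE.
  rewrite linear_sum scaler_sumr.
  under eq_bigr => l lN do rewrite linearZ /= scalerA.
  over.
rewrite exchange_big; apply: eq_bigr => l lN.
rewrite (reindex_inj (mulgI l)) /=; apply: eq_big => [t|t tN].
  by rewrite groupMl.
rewrite groupMl // in tN.
have -> : ((l * t)^-1 * n = t^-1 * (l^-1 * n))%g by rewrite !gnorm.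
rewrite mulKg; congr (_ *: _); rewrite /gen_comul_coef.
have ltN := groupM lN tN; have lV := groupVr lN; have tV := groupVr tN.
have := dat_gamma_cocycle tV lV nN; have := dat_gamma_cocycle tV lV ltN.
rewrite -invMg mulKg => E1 E2.
have ne1 := dat_gamma_neq0 (groupVr ltN) ltN; have ne2 := dat_gamma_neq0 tV lV.
have ne3 := dat_gamma_neq0 lV lN; have ne4 := dat_gamma_neq0 tV tN.
apply: (mulfI ne2); rewrite !mulrA E2.
have -> : gamma t^-1%g (l^-1 * n)%g * gamma l^-1%g n / gamma (l * t)^-1%g (l * t)%g *
  gamma l^-1%g (l * t)%g / gamma l^-1%g l =
  gamma t^-1%g (l^-1 * n)%g * gamma l^-1%g n * (gamma t^-1%g t * gamma l^-1%g (l * t)%g) /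
  (gamma (l * t)^-1%g (l * t)%g * gamma l^-1%g l * gamma t^-1%g t).
  by field; rewrite ne1 ne3 ne4.
by rewrite -E1; field; rewrite ne1 ne3 ne4.
Qed.

Lemma gen_counitl : (tunitl A \o tensl (gen_counit d) \1 \o gen_comul)%VF = \1%VF.
Proof.
apply: gen_ext => g n nN; rewrite !comp_lfunE gen_comulE // !linear_sum.
rewrite (bigD1 1%g) //= big1 => [|m /andP[mN /negbTE m1]]; last first.
  by rewrite !linearZ /= tensl_tens gen_counitE // m1 tens0l linear0 scaler0.
rewrite addr0 !linearZ /= tensl_tens gen_counitE // eqxx tunitl_tens !id_lfunE.
by rewrite /gen_comul_coef invg1 !gamma1l // divr1 mul1g !scale1r.
Qed.

Lemma gen_counitr : (tunitr A \o tensl \1 (gen_counit d) \o gen_comul)%VF = \1%VF.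
Proof.
apply: gen_ext => g n nN; rewrite !comp_lfunE gen_comulE // !linear_sum.
rewrite (bigD1 n) //= big1 => [|m /andP[mN m1]]; last first.
  rewrite !linearZ /= tensl_tens gen_counitE ?groupM ?groupV //.
  by rewrite -eq_mulVg1 (negbTE m1) linear0 linear0 scaler0.
rewrite addr0 !linearZ /= tensl_tens gen_counitE ?groupM ?groupV //.
rewrite mulVg eqxx tunitr_tens !id_lfunE scale1r /gen_comul_coef divff ?scale1r //.
by rewrite dat_gamma_neq0 ?groupV.
Qed.

Lemma gen_coalgebra : is_yd_coalgebra Y gen_comul (gen_counit d).
Proof.
split; [exact: gen_comul_mor|exact: gen_counit_mor|exact: gen_coassoc|..].
  exact: gen_counitl.
exact: gen_counitr.
Qed.

(** Left multiplication by [a_ x n] moves the summand of index [l] to the one of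
    index [n l]; the coefficients match by two instances of the cocycle identity
    starting with [(n l)^-1, n]. *)
Lemma gen_frob_left :
  (tensl (gen_mulm d) \1 \o tassoc_inv A A A \o tensl \1 gen_comul =
   gen_comul \o gen_mulm d)%VF.
Proof.
apply: gen_ext2 => g n x m nN mN; rewrite !comp_lfunE tensl_tens id_lfunE gen_mulmE.
rewrite gen_comulE // !linear_sum.
have [tH|tH] := boolP (x^-1 * g \in H)%g; last first.
  rewrite gen_mul_diff // linear0 big1 // => l lN.
  rewrite !linearZ /= tassoc_inv_tens tensl_tens gen_mulmE gen_mul_diff //.
  by rewrite tens0l scaler0.
rewrite (gen_move tH nN); set n' := (_ * n * _)%g; set c := eps _ n.
have n'N : n' \in N by rewrite datJ.
move: n' n'N c => {tH nN}n' n'N c.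
rewrite gen_mulZl gen_mul_same // !linearZ /= gen_comulE ?(groupM n'N) //.
rewrite !scaler_sumr [RHS](reindex_inj (mulgI n')) /=.
apply: eq_big => [l|l lN]; first by rewrite groupMl.
rewrite !linearZ /= tassoc_inv_tens tensl_tens gen_mulmE gen_mulZl gen_mul_same //.
rewrite !tensZl id_lfunE !scalerA.
have -> : ((n' * l)^-1 * (n' * m) = l^-1 * m)%g by rewrite !gnorm.
congr (_ *: _); rewrite /gen_comul_coef.
have n'lN := groupM n'N lN; have lV := groupVr lN.
have := dat_gamma_cocycle (groupVr n'lN) n'N mN.
have := dat_gamma_cocycle (groupVr n'lN) n'N lN.
have -> : ((n' * l)^-1 * n' = l^-1)%g by rewrite !gnorm.
move=> E1 E2; have ne1 := dat_gamma_neq0 (groupVr n'lN) n'lN.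
have ne2 := dat_gamma_neq0 lV lN; have ne3 := dat_gamma_neq0 (groupVr n'lN) n'N.
have ne4 := dat_gamma_neq0 n'N lN.
have E3 : gamma n' l =
    gamma (n' * l)^-1%g n' * gamma l^-1%g l / gamma (n' * l)^-1%g (n' * l)%g.
  by rewrite E1 mulrC mulKf.
have E4 : gamma n' m * gamma (n' * l)^-1%g (n' * m)%g =
    gamma (n' * l)^-1%g n' * gamma l^-1%g m.
  by rewrite E2 mulrC.
rewrite -!mulrA [gamma n' m * _]mulrA E4 E3; field; rewrite ne1 ne2 //.
Qed.

(** The comultiplication of [a_ g n] is the Casimir element at [g] multiplied
    by [a_ g n] on the right, so compatibility with right multiplication is the
    cocycle identity itself. *)
Lemma gen_frob_right :
  (gen_comul \o gen_mulm d =
   tensl \1 (gen_mulm d) \o tassoc A A A \o tensl gen_comul \1)%VF.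
Proof.
apply: gen_ext2 => g n x m nN mN; rewrite !comp_lfunE tensl_tens id_lfunE gen_mulmE.
rewrite gen_comulE // tens_suml !linear_sum.
have [tH|tH] := boolP (g^-1 * x \in H)%g; last first.
  rewrite coset_sym in tH; rewrite gen_mul_diff // linear0 big1 // => l lN.
  rewrite tensZl !linearZ /= tassoc_tens tensl_tens gen_mulmE gen_mul_diff //.
    by rewrite linear0 scaler0.
  by rewrite groupM ?groupV.
rewrite (gen_move tH mN); set m' := (_ * m * _)%g; set c := eps _ m.
have m'N : m' \in N by rewrite datJ.
move: m' m'N c => {tH mN}m' m'N c.
rewrite linearZ /= gen_mul_same // !linearZ /= gen_comulE ?(groupM nN) //.
rewrite !scaler_sumr; apply: eq_bigr => l lN; have lV := groupVr lN.
have lnN := groupM lV nN.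
rewrite tensZl !linearZ /= tassoc_tens tensl_tens gen_mulmE linearZ /=.
rewrite gen_mul_same // !linearZ /= id_lfunE !scalerA mulgA.
congr (_ *: _); rewrite /gen_comul_coef.
have E := dat_gamma_cocycle lV nN m'N.
transitivity (c * (gamma l^-1%g (n * m')%g * gamma n m') / gamma l^-1%g l).
  by ring.
by rewrite -E; ring.
Qed.

Section Rigid.
Variables (I : finType) (r : I -> gT).
Hypothesis rP : is_coset_decomposition d r.

Lemma gen_special : is_special (gen_mulm d) (gen_unit d r) gen_comul (gen_counit d).
Proof.
exists #|N|%:R, #|[set: gT] : H|%g%:R; split.
- exact: dat_cardN.
- exact: dat_indexH.
- apply: gen_ext => g n nN; rewrite scale_lfunE comp_lfunE id_lfunE gen_comulE //.
  rewrite linear_sum scaler_nat -sumr_const; apply: eq_bigr => m mN.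
  have mV := groupVr mN; have mnN := groupM mV nN.
  rewrite linearZ /= gen_mulmE gen_mul_same // mulKVg scalerA.
  have := dat_gamma_cocycle mN mV nN.
  rewrite mulgV gamma1l // mulr1 /gen_comul_coef gammaV // => ->.
  by rewrite mulrAC [X in X / _]mulrC divff ?scale1r // mulf_neq0 ?dat_gamma_neq0.
apply: lfun_unitP; rewrite scale_lfunE id_lfunE comp_lfunE scal_lfunE scale1r.
by rewrite gen_counit_one // /GRing.scale /= mulr1.
Qed.

Lemma gen_rigid_frobenius :
  is_rigid_frobenius Y (gen_mulm d) (gen_unit d r) gen_comul (gen_counit d).
Proof.
split; [|exact: gen_connected rP|exact: gen_commutative|exact: gen_special].
split; [exact: gen_algebra|exact: gen_coalgebra|exact: gen_frob_left|].
exact: gen_frob_right.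
Qed.

Lemma gen_is_A_algebra : is_A_algebra r Y (gen_mulm d) (gen_unit d r).
Proof.
split=> [x g n nN|g n nN|g x n m nN mN|].
- exact: gen_actE.
- exact: gen_gr.
- rewrite gen_mulmE gen_mulE // lcoset_eqE /gen_mul_val.
  have -> : (x^-1 * g * n * (x^-1 * g)^-1 = x^-1 * g * n * g^-1 * x)%g.
    by rewrite !gnorm.
  by [].
by rewrite scal_lfunE scale1r.
Qed.

Lemma gen_is_A_coalgebra : is_A_coalgebra gen_comul (gen_counit d).
Proof. by split=> g n nN; [apply: gen_comulE | apply: gen_counitE]. Qed.

End Rigid.

End FrobeniusStructure.

(** * Rigid Frobenius algebras *)

Section RigidFrobenius.
Variables (k : fieldType) (gT : finGroupType) (V : vectType k) (Y : ydStruct gT V).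
Variables (m : 'Hom(tensv V V, V)) (u : 'Hom(k^o, V)).
Variables (D : 'Hom(V, tensv V V)) (e : 'Hom(V, k^o)).
Hypothesis rF : is_rigid_frobenius Y m u D e.

Definition amul v w : V := m (tens v w).
Definition lmul v : 'End(V) := linfun (amul v).
Local Notation "v ** w" := (amul v w) (at level 40, left associativity).
Local Notation one := (u 1).
Local Notation act := (yd_act Y).
Local Notation gr := (yd_gr Y).

Let fA : is_yd_algebra Y m u. Proof. by case: rF => -[]. Qed.
Let fC : is_yd_coalgebra Y D e. Proof. by case: rF => -[]. Qed.

Lemma amulDl a v v' w : (a *: v + v') ** w = a *: (v ** w) + v' ** w.
Proof. by rewrite /amul (tens_linearl w a) linearP. Qed.

Lemma amulDr a v v' w : w ** (a *: v + v') = a *: (w ** v) + w ** v'.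
Proof. by rewrite /amul !linearP. Qed.

Lemma amul0l w : 0 ** w = 0. Proof. by rewrite /amul tens0l linear0. Qed.
Lemma amul0r w : w ** 0 = 0. Proof. by rewrite /amul !linear0. Qed.

Lemma amulZl a v w : (a *: v) ** w = a *: (v ** w).
Proof. by rewrite /amul tensZl linearZ. Qed.

Lemma amulZr a v w : v ** (a *: w) = a *: (v ** w).
Proof. by rewrite /amul tensZr linearZ. Qed.

Lemma amul_suml (I : Type) (s : seq I) (P : pred I) (F : I -> V) w :
  (\sum_(i <- s | P i) F i) ** w = \sum_(i <- s | P i) F i ** w.
Proof. by rewrite /amul tens_suml linear_sum. Qed.

Lemma amul_sumr (I : Type) (s : seq I) (P : pred I) (F : I -> V) w :
  w ** (\sum_(i <- s | P i) F i) = \sum_(i <- s | P i) w ** F i.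
Proof. by rewrite /amul !linear_sum. Qed.

Lemma lmulE v w : lmul v w = v ** w.
Proof. by rewrite linfunE // => a x y; apply: amulDr. Qed.

Lemma amulA v w z : (v ** w) ** z = v ** (w ** z).
Proof.
have := congr1 (fun f : 'Hom(_, _) => f (tens (tens v w) z)) (yda_assoc fA).
by rewrite /= !comp_lfunE tassoc_tens !tensl_tens !id_lfunE.
Qed.

Lemma amul1l v : one ** v = v.
Proof.
have := congr1 (fun f : 'Hom(_, _) => f (tens (1 : k^o) v)) (yda_unitl fA).
by rewrite /= comp_lfunE tensl_tens tunitl_tens id_lfunE scale1r.
Qed.

Lemma amul1r v : v ** one = v.
Proof.
have := congr1 (fun f : 'Hom(_, _) => f (tens v (1 : k^o))) (yda_unitr fA).
by rewrite /= comp_lfunE tensl_tens tunitr_tens id_lfunE scale1r.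
Qed.

Lemma act_mul x v w : act x (v ** w) = act x v ** act x w.
Proof. by have [<- _] := yda_mul_mor fA; rewrite /= tensl_tens. Qed.

Lemma one_gr : one \in gr 1%g.
Proof. by apply: (yda_unit_mor fA).2; rewrite /= /unit_gr eqxx memvf. Qed.

Lemma mul_gr g h v w : v \in gr g -> w \in gr h -> v ** w \in gr (g * h)%g.
Proof. by move=> vg wh; apply: (yda_mul_mor fA).2; apply: tens_gr_tens. Qed.

Lemma amulC g v w : v \in gr g -> v ** w = act g w ** v.
Proof.
move=> vg; have [_ _ comm _] := rF.
by rewrite {1}/amul comm comp_lfunE (ydBraid_tens _ vg).
Qed.

(** The trivial degree part is central because its elements braid trivially. *)
Lemma amulC1 v w : v \in gr 1%g -> v ** w = w ** v.
Proof. by move=> v1; rewrite (amulC w v1) yd_act1 id_lfunE. Qed.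

Lemma yd_actKV x v : act x (act x^-1%g v) = v.
Proof. by rewrite -comp_lfunE -yd_actM mulgV yd_act1 id_lfunE. Qed.

Lemma e_act x v : e (act x v) = e v.
Proof. by have [-> _] := ydc_counit_mor fC; rewrite /= id_lfunE. Qed.

Lemma e_gr g v : v \in gr g -> g != 1%g -> e v = 0.
Proof.
move=> vg /negbTE g1; have [_ /(_ g v vg)] := ydc_counit_mor fC.
by rewrite /= /unit_gr g1 memv0 => /eqP.
Qed.

Lemma comp_mul1 g v w : v \in gr 1%g -> yd_comp Y g (v ** w) = v ** yd_comp Y g w.
Proof.
move=> v1; rewrite -!lmulE -(@graded_comp _ _ _ _ Y Y) // => h z zh.
by rewrite lmulE -[h in gr h]mul1g mul_gr.
Qed.

(* The Casimir element [D 1] is the sum of the tensors of [b i] and [y i]. *)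
Local Notation b i := (vbasis {:V})`_i.
Local Notation y i := (tens_row (D one) i).

Lemma comul_mulr v : D v = \sum_(i < \dim {:V}) tens (b i) (y i ** v).
Proof.
have [[_ _ _ fr] _ _ _] := rF.
have := congr1 (fun f : 'Hom(_, _) => f (tens one v)) fr.
rewrite /= !comp_lfunE -/(amul _ _) amul1l => ->.
rewrite tensl_tens id_lfunE {1}(tens_rows (D one)) tens_suml !linear_sum.
by apply: eq_bigr => i _; rewrite /= tassoc_tens tensl_tens id_lfunE.
Qed.

Lemma comul_mull v : D v = \sum_(i < \dim {:V}) tens (v ** b i) (y i).
Proof.
have [[_ _ fl _] _ _ _] := rF.
have := congr1 (fun f : 'Hom(_, _) => f (tens v one)) fl.
rewrite /= !comp_lfunE -/(amul _ _) amul1r => <-.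
rewrite tensl_tens id_lfunE {1}(tens_rows (D one)) !linear_sum.
by apply: eq_bigr => i _; rewrite /= tassoc_inv_tens tensl_tens id_lfunE.
Qed.

Lemma casimir_lfun (W : vectType k) (F : 'Hom(tensv V V, W)) v :
  \sum_(i < \dim {:V}) F (tens (v ** b i) (y i)) =
  \sum_(i < \dim {:V}) F (tens (b i) (y i ** v)).
Proof. by rewrite -!linear_sum -comul_mull -comul_mulr. Qed.

(** The counit axioms say that the components of the Casimir element are dual
    bases for the form [e (v ** w)]. *)
Lemma dual_basisl v : v = \sum_(i < \dim {:V}) (e (v ** b i) : k) *: y i.
Proof.
have := congr1 (fun f : 'Hom(_, _) => f v) (ydc_counitl fC).
rewrite /= !comp_lfunE id_lfunE comul_mull !linear_sum => E; rewrite -[LHS]E.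
by apply: eq_bigr => i _; rewrite /= tensl_tens tunitl_tens id_lfunE.
Qed.

Lemma dual_basisr v : v = \sum_(i < \dim {:V}) (e (y i ** v) : k) *: b i.
Proof.
have := congr1 (fun f : 'Hom(_, _) => f v) (ydc_counitr fC).
rewrite /= !comp_lfunE id_lfunE comul_mulr !linear_sum => E; rewrite -[LHS]E.
by apply: eq_bigr => i _; rewrite /= tensl_tens tunitr_tens id_lfunE.
Qed.

Lemma form_nondegl v : v != 0 -> exists w, e (v ** w) != 0.
Proof.
move=> v0; have [i ei|e0] := pickP (fun i : 'I_(\dim {:V}) => e (v ** b i) != 0).
  by exists (b i).
case/eqP: v0; rewrite (dual_basisl v) big1 // => i _.
by move/eqP: (negbFE (e0 i)) => ->; rewrite scale0r.
Qed.

(** The form vanishes on products of nontrivial degree. *)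
Lemma form_nondeg_gr g v : v \in gr g -> v != 0 ->
  exists2 w, w \in gr g^-1%g & e (v ** w) != 0.
Proof.
move=> vg /form_nondegl[w ew]; exists (yd_comp Y g^-1%g w); first exact: yd_comp_mem.
apply: contra ew => /eqP ev0; rewrite -[w](yd_comp_sum Y) amul_sumr linear_sum.
rewrite (bigD1 g^-1%g) //= ev0 add0r big1 // => h hg.
rewrite (e_gr (mul_gr vg (yd_comp_mem Y h w))) //.
by apply: contra hg => /eqP gh; rewrite eq_sym eq_invg_mul gh.
Qed.

(** The maps [x ⊗ y ↦ e (a x) y] separate tensors: by [dual_basisr], summing
    [b i ⊗ e (y i x) y] over [i] gives back [x ⊗ y].  As the comultiplication has
    values [a v] under these maps, it is determined by the product and the
    form. *)
Lemma tens_form_eq (T T' : tensv V V) :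
  (forall a, tunitl V (tensl (e \o lmul a)%VF \1%VF T) =
             tunitl V (tensl (e \o lmul a)%VF \1%VF T')) -> T = T'.
Proof.
pose R : 'End(tensv V V) := \sum_(i < \dim {:V})
  (linfun (tens (b i) : V -> tensv V V) \o
   tunitl V \o tensl (e \o lmul (y i))%VF \1%VF)%VF.
have RE : R = \1%VF.
  apply: lfun_tensP => v w; rewrite sum_lfunE id_lfunE [in RHS](dual_basisr v).
  rewrite tens_suml; apply: eq_bigr => i _; rewrite !comp_lfunE tensl_tens.
  by rewrite tunitl_tens comp_lfunE lmulE id_lfunE lfunE /= tensZl tensZr.
move=> TT'; rewrite -[T]id_lfunE -[T' in RHS]id_lfunE -RE !sum_lfunE.
by apply: eq_bigr => i _; rewrite !comp_lfunE TT'.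
Qed.

Lemma comul_form a v : tunitl V (tensl (e \o lmul a)%VF \1%VF (D v)) = a ** v.
Proof.
rewrite [RHS]dual_basisl comul_mull !linear_sum; apply: eq_bigr => i _.
by rewrite /= tensl_tens tunitl_tens comp_lfunE lmulE id_lfunE amulA.
Qed.

Lemma separability : exists2 beta : k, beta != 0 &
  \sum_(i < \dim {:V}) b i ** y i = beta *: one.
Proof.
have [_ _ _ [beta [_ [b0 _ mD _]]]] := rF; exists beta => //.
have := congr1 (fun f : 'Hom(_, _) => f one) mD.
rewrite /= comp_lfunE scale_lfunE id_lfunE => <-.
by rewrite [in RHS](tens_rows (D one)) linear_sum.
Qed.

(** Separability makes the trivial degree part von Neumann regular: averaging a
    projection [P] onto the ideal generated by [v] over the Casimir element gives
    [beta v = \sum_i b i P (y i v) = v \sum_i b i P (y i)], and [P (y i)] is a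
    multiple of [v]. *)
Lemma regular1 v : v \in gr 1%g ->
  exists2 a, a \in gr 1%g & v = v ** (v ** a).
Proof.
move=> v1; have [beta b0 sep] := separability.
pose P := projv (limg (lmul v)).
pose z i := ((lmul v)^-1 (P (y i)))%VF.
have zE i : P (y i) = v ** z i by rewrite -lmulE limg_lfunVK ?memv_proj.
have bv : beta *: v = v ** (v ** \sum_(i < \dim {:V}) b i ** z i).
  have := casimir_lfun (m \o tensl \1 P)%VF v.
  under eq_bigr => i _ do rewrite comp_lfunE tensl_tens id_lfunE zE -/(amul _ _).
  under [RHS]eq_bigr => i _.
    rewrite comp_lfunE tensl_tens id_lfunE -(amulC1 _ v1) projv_id; last first.
      by rewrite -lmulE memv_img ?memvf.
    rewrite -/(amul _ _) (amulC1 _ v1) -amulA.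
    over.
  rewrite -amul_suml sep amulZl amul1l => <-.
  rewrite !amul_sumr; apply: eq_bigr => i _.
  by rewrite !amulA; congr (_ ** _); rewrite -!amulA (amulC1 _ v1).
exists (yd_comp Y 1%g (beta^-1 *: \sum_(i < \dim {:V}) b i ** z i)).
  exact: yd_comp_mem.
rewrite -!comp_mul1 // !amulZr -bv scalerA mulVf // scale1r.
by rewrite (yd_comp_id _ v1) eqxx.
Qed.

(** Connectedness, with morphisms from the unit object read as their values at
    [1]. *)
Lemma invariant_scalar v : v \in gr 1%g -> (forall x, act x v = v) ->
  exists c : k, v = c *: one.
Proof.
move=> v1 inv; have [_ [H HP dimH] _ _] := rF.
have uH : u \in H by apply/HP; exact: (yda_unit_mor fA).
have vH : scal_lfun v \in H.
  apply/HP; split=> [g c|g c] /=; first by rewrite !scal_lfunE linearZ /= inv id_lfunE.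
  rewrite /unit_gr; case: eqP => [-> _|_]; first by rewrite scal_lfunE rpredZ.
  by rewrite memv0 => /eqP->; rewrite linear0 mem0v.
have [u0|u0] := eqVneq u 0.
  by exists 0; rewrite -[v]amul1l u0 zero_lfunE amul0l scale0r.
have HE : H = <[u]>%VS.
  by apply/esym/eqP; rewrite eqEdim -memvE uH dimH dim_vline u0.
move: vH; rewrite HE => /vlineP[c vc]; exists c.
by rewrite -scale_lfunE -vc scal_lfunE scale1r.
Qed.

Lemma one_neq0 : one != 0.
Proof.
have [_ [H HP dimH] _ _] := rF; apply/negP => /eqP u0.
suff H0 : H = 0%VS by rewrite H0 dimv0 in dimH.
apply/eqP; rewrite -subv0; apply/subvP => f _; rewrite memv0; apply/eqP.
by apply: lfun_unitP; rewrite zero_lfunE -[LHS]amul1l u0 amul0l.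
Qed.

Definition is_primitive1 p :=
  [/\ p \in gr 1%g, p != 0, p ** p = p &
      forall x, x \in gr 1%g -> exists a : k, p ** x = a *: p].

End RigidFrobenius.

(** * Primitive idempotents of trivial degree *)

Lemma closed_eigenvector (k : closedFieldType) (V : vectType k) (W : {vspace V})
    (f : 'End(V)) :
  W != 0%VS -> (forall w, w \in W -> f w \in W) ->
  exists a w, [/\ w \in W, w != 0 & f w = a *: w].
Proof.
move=> W0 fW.
pose A := \matrix_(i, j) coord (vbasis W) j (f (vbasis W)`_i) : 'M[k]_(\dim W).
have [a ra] : exists a, root (char_poly A) a.
  by apply/closed_rootP; rewrite size_char_poly eqSS dimv_eq0.
have /eigenvalueP[v vA v0] : eigenvalue A a by rewrite eigenvalue_root_char.
pose w := \sum_(i < \dim W) v 0 i *: (vbasis W)`_i.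
exists a, w; split.
- by apply: rpred_sum => i _; rewrite rpredZ ?vbasis_mem ?memt_nth.
- apply: contra v0 => /eqP w0; apply/eqP/rowP => i; rewrite mxE.
  by rewrite -[LHS](coord_sum_free _ _ (basis_free (vbasisP W))) -/w w0 linear0.
rewrite linear_sum scaler_sumr.
have fE (i : 'I_(\dim W)) : f (vbasis W)`_i = \sum_(j < \dim W) A i j *: (vbasis W)`_j.
  have bW : (vbasis W)`_i \in W by rewrite vbasis_mem ?memt_nth.
  rewrite {1}(coord_vbasis (fW _ bW)).
  by apply: eq_bigr => j _; rewrite mxE.
transitivity (\sum_(i < \dim W) \sum_(j < \dim W) (v 0 i * A i j) *: (vbasis W)`_j).
  by apply: eq_bigr => i _; rewrite linearZ /= fE scaler_sumr;
    apply: eq_bigr => j _; rewrite scalerA.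
rewrite exchange_big; apply: eq_bigr => j _ /=; rewrite -scaler_suml scalerA.
by congr (_ *: _); have := congr1 (fun M : 'rV_(\dim W) => M 0 j) vA; rewrite !mxE.
Qed.

Section PrimitiveIdempotent.
Variables (k : closedFieldType) (gT : finGroupType) (V : vectType k).
Variables (Y : ydStruct gT V).
Variables (m : 'Hom(tensv V V, V)) (u : 'Hom(k^o, V)).
Variables (D : 'Hom(V, tensv V V)) (e : 'Hom(V, k^o)).
Hypothesis rF : is_rigid_frobenius Y m u D e.
Local Notation "v ** w" := (amul m v w) (at level 40, left associativity).
Local Notation gr1 := (yd_gr Y 1%g).

(** An idempotent [p] generating an ideal of minimal dimension is primitive.
    Otherwise some [y = p x - a p], with [a] an eigenvalue of [p x] on [p A_1],
    is nonzero and kills a nonzero vector; by regularity [y = y y b], so [y b] is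
    a nonzero idempotent generating a strictly smaller ideal. *)
Lemma primitive1_exists : exists p, is_primitive1 Y m p.
Proof.
have mul11 v w : v \in gr1 -> w \in gr1 -> v ** w \in gr1.
  by move=> v1 w1; rewrite -[1%g]mulg1; apply: (mul_gr rF).
suff: forall n p, p \in gr1 -> p != 0 -> p ** p = p ->
    (\dim (lmul m p @: gr1)%VS <= n)%N -> exists p, is_primitive1 Y m p.
  move=> IH; apply: (IH (\dim {:V}) (u 1)); first exact: (one_gr rF).
  - exact: (one_neq0 rF).
  - exact: (amul1l rF).
  exact/dimvS/subvf.
elim=> [p p1 p0 pp|n IHn p p1 p0 pp].
  rewrite leqn0 dimv_eq0 => /eqP W0; case/negP: p0.
  by have := memv_img (lmul m p) p1; rewrite W0 memv0 lmulE pp.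
set W := (lmul m p @: gr1)%VS => dimW.
have memW z : reflect (z \in gr1 /\ p ** z = z) (z \in W).
  apply: (iffP idP) => [/memv_imgP[z' z'1 ->]|[z1 pz]].
    by rewrite lmulE -(amulA rF) pp mul11.
  by rewrite -[z]pz -lmulE memv_img.
have pW : p \in W by apply/memW.
have [/subvP sub|/subvPn[x xW xp]] := boolP (W <= <[p]>)%VS.
  exists p; split=> // x x1; apply/vlineP; apply: sub.
  by rewrite -lmulE memv_img.
have [x1 px] := memW _ xW.
have W0 : W != 0%VS by apply: contra p0 => /eqP WE; rewrite -memv0 -WE.
have xWW w : w \in W -> lmul m x w \in W.
  move=> /memW[w1 pw]; apply/memW; rewrite lmulE mul11 //; split=> //.
  by rewrite -(amulA rF) px.
have [a [w [wW w0 xw]]] := closed_eigenvector W0 xWW.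
have [w1 pw] := memW _ wW.
pose y := x - a *: p.
have y1 : y \in gr1 by rewrite rpredB ?rpredZ.
have y0 : y != 0.
  by apply: contra xp; rewrite subr_eq0 => /eqP->; apply/vlineP; exists a.
have yE z : y ** z = x ** z - a *: (p ** z).
  by rewrite /y addrC -scaleNr amulDl addrC scaleNr.
have yw : y ** w = 0 by rewrite yE -lmulE xw pw subrr.
have [b b1 yb] := regular1 rF y1.
have py : p ** y = y by rewrite (amulC1 rF _ p1) yE (amulC1 rF p x1) px pp.
pose q := y ** b.
have q1 : q \in gr1 by apply: mul11.
have yq : y ** q = y by [].
apply: (IHn q) => //.
- by apply: contra y0 => /eqP q0; rewrite -yq q0 amul0r.
- by rewrite /q -(amulA rF) (amulC1 rF _ q1) -/q yq.
have qW : (lmul m q @: gr1 <= W)%VS.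
  apply/subvP => _ /memv_imgP[z z1 ->]; apply/memW; rewrite lmulE mul11 //.
  by split=> //; rewrite /q -!(amulA rF) py.
rewrite -ltnS; apply: leq_trans dimW; rewrite ltn_neqAle dimvS // andbT.
apply/negP => /eqP dimE.
have: w \in (lmul m q @: gr1)%VS.
  have /eqP-> // : (lmul m q @: gr1)%VS == W.
  by rewrite eqEdim qW dimE leqnn.
case/memv_imgP => z z1 wE; case/eqP: w0.
have qq : q ** q = q by rewrite /q -(amulA rF) (amulC1 rF _ q1) -/q yq.
have qw : q ** w = w by rewrite wE lmulE -(amulA rF) qq.
by rewrite -qw /q (amulC1 rF _ y1) (amulA rF) yw amul0r.
Qed.

End PrimitiveIdempotent.

(** * The datum of a rigid Frobenius algebra *)

Section Coefficient.
Variables (k : fieldType) (V : vectType k).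

(** Meaningful for [v] on the line of [w]: it is then the quotient of [v] by [w]. *)
Definition line_coef (v w : V) : k := coord [tuple w] ord0 v.

Lemma line_coefE v w : w != 0 -> (exists a, v = a *: w) -> v = line_coef v w *: w.
Proof.
move=> w0 [a ->]; rewrite /line_coef linearZ /=; congr (_ *: _).
have fw : free [tuple w] by rewrite /= seq1_free.
by have := coord_free ord0 ord0 fw; rewrite /= => ->; rewrite ?eqxx mulr1.
Qed.

Lemma scale_vec_inj (v : V) (a b : k) : v != 0 -> a *: v = b *: v -> a = b.
Proof.
move=> v0 /eqP; rewrite -subr_eq0 -scalerBl scaler_eq0 (negbTE v0) orbF.
by rewrite subr_eq0 => /eqP.
Qed.

End Coefficient.

Section DatumOfAlgebra.
Variables (k : fieldType) (gT : finGroupType) (V : vectType k) (Y : ydStruct gT V).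
Variables (m : 'Hom(tensv V V, V)) (u : 'Hom(k^o, V)).
Variables (D : 'Hom(V, tensv V V)) (e : 'Hom(V, k^o)).
Hypothesis rF : is_rigid_frobenius Y m u D e.
Local Notation "v ** w" := (amul m v w) (at level 40, left associativity).
Local Notation act := (yd_act Y).
Local Notation gr := (yd_gr Y).
Variable p : V.
Hypothesis pP : is_primitive1 Y m p.

Let p1 : p \in gr 1%g. Proof. by case: pP. Qed.
Let p0 : p != 0. Proof. by case: pP. Qed.
Let pp : p ** p = p. Proof. by case: pP. Qed.
Let pC v : p ** v = v ** p. Proof. exact: (amulC1 rF). Qed.
Let mA := amulA rF.

(** The ideal [p V] is called the block of [p]. *)
Definition in_block g v := (v \in gr g) && (p ** v == v).

Lemma in_blockP g v : reflect (v \in gr g /\ p ** v = v) (in_block g v).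
Proof. by apply: (iffP andP) => -[? /eqP]. Qed.

Lemma block_p : in_block 1%g p.
Proof. exact/in_blockP. Qed.

Lemma blockZ g c v : in_block g v -> in_block g (c *: v).
Proof. by move=> /in_blockP[vg pv]; apply/in_blockP; rewrite rpredZ // amulZr pv. Qed.

Lemma blockM g h v w : in_block g v -> in_block h w -> in_block (g * h)%g (v ** w).
Proof.
move=> /in_blockP[vg pv] /in_blockP[wh pw]; apply/in_blockP.
by rewrite (mul_gr rF) // -mA pv.
Qed.

Lemma block_comp g v : in_block g (p ** yd_comp Y g v).
Proof.
apply/in_blockP; split; last by rewrite -mA pp.
by rewrite -[g]mul1g (mul_gr rF) // mul1g yd_comp_mem.
Qed.

Lemma block1_scalar v : in_block 1%g v -> exists a : k, v = a *: p.
Proof.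
by move=> /in_blockP[v1 pv]; have [_ _ _ /(_ v v1)[a pa]] := pP; exists a; rewrite -pv.
Qed.

Lemma e_p_neq0 : e p != 0.
Proof.
have [w w1] := form_nondeg_gr rF p1 p0; rewrite invg1 in w1.
have [_ _ _ /(_ w w1)[a ->]] := pP.
by apply: contra => /eqP ep; rewrite linearZ /= ep scaler0.
Qed.

Lemma block_rinv g v : in_block g v -> v != 0 ->
  exists2 w, in_block g^-1%g w & v ** w = p.
Proof.
move=> vg v0; have /in_blockP[vG pv] := vg.
have [w wg ew] := form_nondeg_gr rF vG v0.
have pw : in_block g^-1%g (p ** w).
  by apply/in_blockP; rewrite -mA pp -[(g^-1)%g]mul1g (mul_gr rF).
have vpw : v ** (p ** w) = v ** w by rewrite -mA -pC pv.
have [a va] : exists a : k, v ** w = a *: p.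
  by apply: block1_scalar; rewrite -vpw -[1%g](mulgV g) blockM.
have a0 : a != 0.
  by apply: contra ew => /eqP a0; rewrite va a0 scale0r linear0.
exists (a^-1 *: (p ** w)); first exact: blockZ.
by rewrite amulZr vpw va scalerA mulVf // scale1r.
Qed.

(** Nonzero homogeneous elements of the block are invertible: the form pairs
    [v] nontrivially with the inverse degree, and the block has trivial degree
    part [k p]. *)
Lemma block_inv g v : in_block g v -> v != 0 ->
  exists w, [/\ in_block g^-1%g w, v ** w = p & w ** v = p].
Proof.
move=> vg v0; have [w wg vw] := block_rinv vg v0; exists w; split=> //.
have w0 : w != 0 by apply: contra p0 => /eqP w0; rewrite -vw w0 amul0r.
have [w' w'g ww'] := block_rinv wg w0.
have /in_blockP[_ pv] := vg; have /in_blockP[_ pw'] := w'g.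
suff -> : v = w' by [].
by rewrite -pw' -vw mA ww' -pC.
Qed.

Lemma blockM_neq0 g h v w : in_block g v -> in_block h w ->
  v != 0 -> w != 0 -> v ** w != 0.
Proof.
move=> vg wh v0 w0; have [v' [_ _ v'v]] := block_inv vg v0.
have /in_blockP[_ pw] := wh.
by apply: contra w0 => /eqP vw; rewrite -pw -v'v mA vw amul0r.
Qed.

(** An invertible [v] divides [v'], with a quotient of trivial degree. *)
Lemma block_line g v v' : in_block g v -> v != 0 -> in_block g v' ->
  exists a : k, v' = a *: v.
Proof.
move=> vg v0 v'g; have [w [wg vw _]] := block_inv vg v0.
have /in_blockP[_ pv'] := v'g; have /in_blockP[_ pv] := vg.
have [a wv'] : exists a : k, w ** v' = a *: p.
  by apply: block1_scalar; rewrite -[1%g](mulVg g) blockM.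
by exists a; rewrite -pv' -vw mA wv' amulZr -pC pv.
Qed.

Definition stab_set := [set g | act g p == p].

Lemma stab_group_set : group_set stab_set.
Proof.
apply/group_setP; split=> [|g h]; first by rewrite inE yd_act1 id_lfunE.
by rewrite !inE yd_actM comp_lfunE => /eqP gp /eqP->; rewrite gp.
Qed.

Definition stab : {group gT} := Group stab_group_set.

Lemma stabE g : (g \in stab) = (act g p == p). Proof. by rewrite inE. Qed.

Lemma block_act h g v : h \in stab -> in_block g v ->
  in_block (h * g * h^-1)%g (act h v).
Proof.
rewrite stabE => /eqP hp /in_blockP[vg pv]; apply/in_blockP.
by rewrite yd_act_gr // -{1}hp -(act_mul rF) pv.
Qed.

Lemma act_neq0 g v : v != 0 -> act g v != 0.
Proof.
apply: contra => /eqP gv; rewrite -[v]id_lfunE -(yd_act1 Y) -(mulVg g).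
by rewrite yd_actM comp_lfunE gv linear0.
Qed.

Definition supp_set := [set g | (lmul m p @: gr g)%VS != 0%VS].

Lemma suppP g : reflect (exists2 v, in_block g v & v != 0) (g \in supp_set).
Proof.
rewrite inE; apply: (iffP idP) => [W0|[v /in_blockP[vg pv] v0]].
  exists (vpick (lmul m p @: gr g)%VS); last by rewrite vpick0.
  have /memv_imgP[w wg ->] := memv_pick (lmul m p @: gr g)%VS.
  by apply/in_blockP; rewrite lmulE -mA pp -[g]mul1g (mul_gr rF) // mul1g.
by apply: contra v0 => /eqP W0; rewrite -memv0 -W0 -pv -lmulE memv_img.
Qed.

Lemma supp_group_set : group_set supp_set.
Proof.
apply/group_setP; split=> [|g h].
  by apply/suppP; exists p; rewrite ?block_p.
move=> /suppP[v vg v0] /suppP[w wh w0]; apply/suppP; exists (v ** w).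
  exact: blockM.
exact: (blockM_neq0 vg wh).
Qed.

Definition supp : {group gT} := Group supp_group_set.

(** For [v] of degree [n] in the block, commutativity gives
    [v = v p = (n p) v]; cancelling [v] yields [n p p = p], and the same for
    [n^-1]. *)
Lemma supp_sub_stab : supp \subset stab.
Proof.
have H1 n : n \in supp -> act n p ** p = p.
  move=> /suppP[v vn v0]; have [w [_ vw _]] := block_inv vn v0.
  have /in_blockP[vg pv] := vn.
  by rewrite -{2}vw -mA -(amulC rF p vg) -pC pv vw.
apply/subsetP => n nN; rewrite stabE; apply/eqP.
have := congr1 (act n) (H1 _ (groupVr nN)).
by rewrite (act_mul rF) (yd_actKV Y) pC H1.
Qed.

Lemma supp_normal : (supp <| stab)%g.
Proof.
apply/andP; split; first exact: supp_sub_stab.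
apply/subsetP => h hH; rewrite inE; apply/subsetP => _ /imsetP[n nN ->].
have /suppP[v vn v0] := nN; apply/suppP; exists (act h^-1%g v); last exact: act_neq0.
have -> : (n ^ h = h^-1 * n * h^-1^-1)%g by rewrite conjgE invgK mulgA.
by apply: block_act; rewrite ?groupV.
Qed.

(** The homogeneous components of the block are lines, and [block_gen n] spans
    the one of degree [n].  The choice of [p] in trivial degree normalizes the
    cocycle [block_gamma]. *)
Definition block_gen n : V :=
  if n == 1%g then p else vpick (lmul m p @: gr n)%VS.

Lemma block_gen1 : block_gen 1%g = p. Proof. by rewrite /block_gen eqxx. Qed.

Lemma block_gen_neq0 n : n \in supp -> block_gen n != 0.
Proof. by rewrite inE /block_gen; case: (n =P 1%g) => // _; rewrite vpick0. Qed.

Lemma block_gen_in n : n \in supp -> in_block n (block_gen n).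
Proof.
move=> _; rewrite /block_gen; case: eqP => [->|_]; first exact: block_p.
have /memv_imgP[w wg ->] := memv_pick (lmul m p @: gr n)%VS.
by apply/in_blockP; rewrite lmulE -mA pp -[n]mul1g (mul_gr rF) // mul1g.
Qed.

Lemma mulp_block_gen n : n \in supp -> p ** block_gen n = block_gen n.
Proof. by move=> /block_gen_in/in_blockP[]. Qed.

Definition block_gamma n l :=
  line_coef (block_gen n ** block_gen l) (block_gen (n * l)%g).
Definition block_eps h n :=
  line_coef (act h (block_gen n)) (block_gen (h * n * h^-1)%g).

Lemma block_gammaE n l : n \in supp -> l \in supp ->
  block_gen n ** block_gen l = block_gamma n l *: block_gen (n * l)%g.
Proof.
move=> nN lN; have nlN := groupM nN lN; apply: line_coefE; rewrite ?block_gen_neq0 //.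
by apply: block_line;
  [apply: block_gen_in|apply: block_gen_neq0|apply: blockM; apply: block_gen_in].
Qed.

Lemma suppJ h n : h \in stab -> n \in supp -> (h * n * h^-1 \in supp)%g.
Proof.
move=> hH nN; have -> : (h * n * h^-1 = n ^ h^-1)%g by rewrite conjgE invgK mulgA.
by rewrite memJ_norm // groupV (subsetP (normal_norm supp_normal)).
Qed.

Lemma block_epsE h n : h \in stab -> n \in supp ->
  act h (block_gen n) = block_eps h n *: block_gen (h * n * h^-1)%g.
Proof.
move=> hH nN; have hnN := suppJ hH nN; apply: line_coefE; rewrite ?block_gen_neq0 //.
by apply: block_line;
  [apply: block_gen_in|apply: block_gen_neq0|apply/block_act/block_gen_in].
Qed.

Lemma block_gamma_neq0 : {in supp &, forall n l, block_gamma n l != 0}.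
Proof.
move=> n l nN lN.
have := blockM_neq0 (block_gen_in nN) (block_gen_in lN)
  (block_gen_neq0 nN) (block_gen_neq0 lN).
by rewrite block_gammaE // scaler_eq0 negb_or => /andP[].
Qed.

Lemma block_gamma_cocycle : {in supp & &, forall n l r,
  block_gamma n l * block_gamma (n * l)%g r =
  block_gamma n (l * r)%g * block_gamma l r}.
Proof.
move=> n l r nN lN rN; have nlN := groupM nN lN; have lrN := groupM lN rN.
apply: (scale_vec_inj (block_gen_neq0 (groupM nlN rN))).
have := mA (block_gen n) (block_gen l) (block_gen r).
rewrite (block_gammaE nN lN) (block_gammaE lN rN) amulZl amulZr !block_gammaE //.
by rewrite !scalerA mulgA => ->; rewrite mulrC.
Qed.

Lemma block_gamma_norm :
  {in supp, forall n, block_gamma n 1%g = 1 /\ block_gamma 1%g n = 1}.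
Proof.
move=> n nN; split; apply: (scale_vec_inj (block_gen_neq0 nN)).
  by rewrite -{2}[n]mulg1 -block_gammaE // block_gen1 -pC mulp_block_gen // scale1r.
by rewrite -{2}[n]mul1g -block_gammaE // block_gen1 mulp_block_gen // scale1r.
Qed.

Lemma block_eps_neq0 : {in stab & supp, forall h n, block_eps h n != 0}.
Proof.
move=> h n hH nN; have := act_neq0 h (block_gen_neq0 nN).
by rewrite block_epsE // scaler_eq0 negb_or => /andP[].
Qed.

Lemma block_eps_mulH : {in stab & stab & supp, forall g h n,
  block_eps (g * h)%g n = block_eps g (h * n * h^-1)%g * block_eps h n}.
Proof.
move=> g h n gH hH nN; have ghH := groupM gH hH; have hnN := suppJ hH nN.
apply: (scale_vec_inj (block_gen_neq0 (suppJ ghH nN))).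
rewrite -block_epsE // yd_actM comp_lfunE (block_epsE hH nN) linearZ /= block_epsE //.
by rewrite scalerA mulrC !gnorm.
Qed.

Lemma block_eps_mulN : {in stab & supp & supp, forall h n l,
  block_eps h (n * l)%g * block_gamma n l =
  block_eps h n * block_eps h l * block_gamma (h * n * h^-1)%g (h * l * h^-1)%g}.
Proof.
move=> h n l hH nN lN; have nlN := groupM nN lN.
apply: (scale_vec_inj (block_gen_neq0 (suppJ hH nlN))).
have := act_mul rF h (block_gen n) (block_gen l).
have hnN := suppJ hH nN; have hlN := suppJ hH lN.
rewrite (block_gammaE nN lN) linearZ /= !block_epsE // amulZl amulZr block_gammaE //.
by rewrite !scalerA [block_gamma n l * _]mulrC !gnorm.
Qed.

Lemma block_eps_comm : {in supp &, forall n l,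
  block_gamma n l = block_eps n l * block_gamma (n * l * n^-1)%g n}.
Proof.
move=> n l nN lN; have nH := subsetP supp_sub_stab n nN.
apply: (scale_vec_inj (block_gen_neq0 (groupM nN lN))).
have nlN := suppJ nH lN; have /in_blockP[ng _] := block_gen_in nN.
rewrite -block_gammaE // (amulC rF _ ng) block_epsE // amulZl.
by rewrite block_gammaE // scalerA !gnorm.
Qed.

(** In the block, multiplication by [a] is recovered from the form and the
    basis of the [block_gen n] with its inverse basis.  Applied to the second
    components of the Casimir element, this computes the separability scalar as
    [|supp| / e p]. *)
Lemma card_supp_neq0 : #|supp|%:R != 0 :> k.
Proof.
have [inv invP] : exists inv : gT -> V, forall n, n \in supp ->
    [/\ in_block n^-1%g (inv n), block_gen n ** inv n = p & inv n ** block_gen n = p].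
  apply: (fin_all_exists (P := fun n w => n \in supp ->
    [/\ in_block n^-1%g w, block_gen n ** w = p & w ** block_gen n = p])) => n.
  have [nN|nN] := boolP (n \in supp); last by exists 0.
  by have [w] := block_inv (block_gen_in nN) (block_gen_neq0 nN); exists w.
have inv_neq0 n : n \in supp -> inv n != 0.
  by move=> /invP[_ _ iv]; apply: contra p0 => /eqP i0; rewrite -iv i0 amul0l.
have t0 := e_p_neq0.
(* The component of degree [n^-1] of [p a], on the line of the inverse of
   [block_gen n], is detected by pairing with [block_gen n]. *)
have compE a n : n \in supp ->
    p ** yd_comp Y n^-1%g a = ((e p)^-1 * (e (a ** block_gen n) : k)) *: inv n.
  move=> nN; have [in1 _ ihn] := invP n nN.
  have [c cE] := block_line in1 (inv_neq0 n nN) (block_comp n^-1%g a).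
  have /in_blockP[ng pn] := block_gen_in nN.
  suff -> : e (a ** block_gen n) = c * e p by rewrite cE mulrCA mulVf // mulr1.
  rewrite -{1}[a](yd_comp_sum Y) amul_suml linear_sum (bigD1 n^-1%g) //= big1.
    by rewrite addr0 -[block_gen n]pn -mA -pC cE amulZl ihn linearZ.
  move=> g gn; rewrite (e_gr rF (mul_gr rF (yd_comp_mem Y g a) ng)) //.
  by apply: contra gn; rewrite [g == _]eq_mulgV1 invgK.
have [beta b0 sep] := separability rF.
pose y i := tens_row (D (u 1)) i; pose b i := (vbasis {:V})`_i.
have yp i : y i ** p =
    \sum_(n in supp) ((e p)^-1 * (e (y i ** block_gen n) : k)) *: inv n.
  rewrite -pC -{1}[y i](yd_comp_sum Y) amul_sumr (reindex_inj invg_inj) /=.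
  rewrite (bigID (fun n => n \in supp)) /= [X in _ + X]big1 ?addr0 => [|n nN].
    by apply: eq_bigr => n nN; rewrite compE.
  apply/eqP; apply: contraR nN => v0.
  suff: n^-1%g \in supp by rewrite groupV.
  apply/suppP; by exists (p ** yd_comp Y n^-1%g (y i)); rewrite ?block_comp.
have: beta *: p = ((e p)^-1 * #|supp|%:R) *: p.
  rewrite -[in LHS](amul1l rF p) -amulZl -sep amul_suml.
  under eq_bigr => i _ do rewrite mA -/(y i) -/(b i) yp amul_sumr.
  rewrite exchange_big -scalerA scaler_nat -sumr_const scaler_sumr.
  apply: eq_bigr => n nN; have [_ hin _] := invP n nN.
  transitivity ((e p)^-1 *: (block_gen n ** inv n)); last by rewrite hin.
  rewrite [X in _ *: (X ** _)](dual_basisr rF (block_gen n)) amul_suml scaler_sumr.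
  by apply: eq_bigr => i _; rewrite amulZr amulZl scalerA.
move/(scale_vec_inj p0) => bE; apply: contra b0 => /eqP N0.
by rewrite bE N0 mulr0.
Qed.

Lemma act_p_gr g : act g p \in gr 1%g.
Proof. by have := yd_act_gr g p1; rewrite mulg1 mulgV. Qed.

(** The product of [p] with a translate [q] is a multiple [a p] and, by the same
    argument for [q], a multiple of [q]; if [a] is nonzero then the idempotents
    [p] and [q] are proportional, hence equal. *)
Lemma idem_orth g : p ** act g p = if g \in stab then p else 0.
Proof.
have q1 := act_p_gr g.
have qq : act g p ** act g p = act g p by rewrite -(act_mul rF) pp.
have [_ _ _ pl] := pP; have [a aE] := pl _ q1.
have r1 := act_p_gr g^-1%g.
have [c] := pl _ r1; move/(congr1 (act g)).
rewrite (act_mul rF) (yd_actKV Y) linearZ /= -pC aE => acE.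
case: ifP => [|/negbT gH].
  by rewrite stabE => /eqP gp; rewrite -aE gp pp.
have [->|a0] := eqVneq a 0; first by rewrite scale0r.
case/negP: gH; rewrite stabE; apply/eqP.
have pE : p = (a^-1 * c) *: act g p by rewrite -scalerA -acE scalerA mulVf // scale1r.
move: (a^-1 * c) pE => b pE.
have b0 : b != 0 by apply: contra p0 => /eqP b0; rewrite pE b0 scale0r.
have: (b * b) *: act g p = b *: act g p.
  rewrite -[X in _ *: X]qq -scalerA -amulZr -amulZl -pE.
  by rewrite pp.
move/(scale_vec_inj (act_neq0 g p0)) => bb.
have b1 : b = 1 by apply: (mulfI b0); rewrite bb mulr1.
by rewrite [in RHS]pE b1 scale1r.
Qed.

Lemma idem_orth2 x y :
  act x p ** act y p = if (x^-1 * y \in stab)%g then act y p else 0.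
Proof.
have -> : act y p = act x (act (x^-1 * y)%g p).
  by rewrite yd_actM comp_lfunE (yd_actKV Y).
rewrite -(act_mul rF) idem_orth; case: ifP => [|_]; last by rewrite linear0.
by rewrite stabE => /eqP->.
Qed.

Section Translates.
Variables (I : finType) (r : I -> gT).
Hypothesis rP : forall x : gT, exists! i : I, x \in (r i *: stab)%g.

(** The sum of the translates of [p] is a unit for every translate of [p], hence
    it is invariant, hence a scalar. *)
Lemma sum_translates : \sum_i act (r i) p = u 1.
Proof.
set S := \sum_i _; have Sact y : S ** act y p = act y p.
  rewrite amul_suml; have [i0 [yi0 uni]] := rP y; rewrite (bigD1 i0) //=.
  rewrite idem_orth2 -mem_lcoset yi0 big1 ?addr0 // => i ne.
  rewrite idem_orth2 -mem_lcoset; case: ifP => // yi; case/eqP: ne.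
  by rewrite (uni i).
have S1 : S \in gr 1%g.
  by apply: memv_suml => i _; apply: act_p_gr.
have inv x : act x S = S.
  have SxS z : S ** act z S = act z S.
    rewrite linear_sum amul_sumr; apply: eq_bigr => i _.
    by rewrite /= -comp_lfunE -yd_actM Sact.
  rewrite -[LHS]SxS (amulC1 rF _ S1) -[in RHS](yd_actKV Y x S) -[in RHS]SxS.
  by rewrite (act_mul rF) (yd_actKV Y).
have [c cE] := invariant_scalar rF S1 inv.
have := Sact 1%g; rewrite yd_act1 id_lfunE cE amulZl (amul1l rF).
rewrite -[in RHS](scale1r p) => /(scale_vec_inj p0) ->; exact: scale1r.
Qed.

End Translates.

(** The form takes the same value [e p] on all translates of [p], so the scalar
    [e 1] of speciality is [e p] times the index. *)
Lemma index_stab_neq0 : #|[set: gT] : stab|%g%:R != 0 :> k.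
Proof.
have [I [r rP]] := coset_decomposition_exists stab.
rewrite -(coset_decomposition_card rP).
have [_ _ _ [_ [b1 [_ b10 _ eu]]]] := rF.
have := congr1 (fun f : 'End(k^o) => f 1) eu.
rewrite /= comp_lfunE scale_lfunE id_lfunE -(sum_translates rP) linear_sum.
under eq_bigr => i _ do rewrite /= (e_act rF).
rewrite sumr_const => bE; apply: contra b10 => /eqP I0.
have : b1 = (e p : k) * #|I|%:R.
  by rewrite mulr_natr -[RHS]/(e p *+ #|I|) bE /GRing.scale /= mulr1.
by move=> ->; rewrite I0 mulr0.
Qed.

Definition rigid_datum : datum k gT := @Datum k gT stab supp block_gamma block_eps
  index_stab_neq0 supp_normal card_supp_neq0 block_gamma_neq0 block_gamma_cocycle
  block_gamma_norm block_eps_neq0 block_eps_mulH block_eps_mulN block_eps_comm.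

End DatumOfAlgebra.

(** * The classification *)

Section Classification.
Variables (k : fieldType) (gT : finGroupType) (V : vectType k) (Y : ydStruct gT V).
Variables (m : 'Hom(tensv V V, V)) (u : 'Hom(k^o, V)).
Variables (D : 'Hom(V, tensv V V)) (e : 'Hom(V, k^o)).
Hypothesis rF : is_rigid_frobenius Y m u D e.
Variable p : V.
Hypothesis pP : is_primitive1 Y m p.
Local Notation "v ** w" := (amul m v w) (at level 40, left associativity).
Local Notation act := (yd_act Y).
Local Notation block_gen := (block_gen Y m p).
Local Notation d := (rigid_datum rF pP).
Local Notation H := (dat_H d).
Local Notation N := (dat_N d).
Local Notation a_ := (a_ d).

(** The isomorphism of the classification, in the direction in which it is
    given on generators. *)
Definition translate_gen : 'Hom(Asp d, V) :=
  gen_lift d (fun g n => act g (block_gen n)).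

Local Notation F := translate_gen.

Lemma translate_genE g n : n \in N -> F (a_ g n) = act g (block_gen n).
Proof.
move=> nN; apply: gen_liftE => // {}g h {nN}n hH nN.
by rewrite yd_actM comp_lfunE (block_epsE hH nN) linearZ.
Qed.

Lemma translate_gen_mor : is_ydmor (gen_yd d) Y F.
Proof.
split=> [x v|g _ /memv_imgP[v _ ->]] /=.
  rewrite -[LHS]comp_lfunE -[RHS]comp_lfunE; congr (fun_of_lfun _ v).
  apply: gen_ext => g n nN; rewrite !comp_lfunE gen_actE // !translate_genE //.
  by rewrite yd_actM comp_lfunE.
elim/gen_ind: v => [|c v w IH1 IH2|x n nN]; first by rewrite !linear0 mem0v.
  by rewrite !linearP /= rpredD ?rpredZ.
rewrite gen_projE //; case: eqP => [<-|_]; last by rewrite linear0 mem0v.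
by rewrite translate_genE // yd_act_gr //; have /in_blockP[] := block_gen_in nN.
Qed.

(** Over one coset this is the definition of [block_gamma] and [block_eps]; over
    different cosets the factors lie in orthogonal blocks. *)
Lemma translate_gen_mul v w : F (gen_mul d v w) = F v ** F w.
Proof.
rewrite -gen_mulmE -comp_lfunE -[RHS]/(m _) -tensl_tens -[RHS]comp_lfunE.
congr (fun_of_lfun _ _); apply: gen_ext2 => g n x l nN lN.
rewrite !comp_lfunE tensl_tens gen_mulmE !translate_genE // -/(amul m _ _).
have genx y j : j \in N -> act y (block_gen j) = act y p ** act y (block_gen j).
  by move=> jN; rewrite -(act_mul rF) (mulp_block_gen jN).
have [tH|tH] := boolP (x^-1 * g \in H)%g; last first.
  rewrite gen_mul_diff // linear0 [act g _]genx // [act x _]genx //.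
  rewrite (amulA rF) -[act g (block_gen n) ** _](amulA rF).
  have -> : act g (block_gen n) ** act x p = act x p ** act g (block_gen n).
    by rewrite (amulC1 rF _ (act_p_gr pP x)).
  rewrite -!(amulA rF) (idem_orth2 rF pP) ifF ?amul0l //.
  by apply/negbTE; rewrite -coset_sym in tH.
rewrite (gen_move tH nN) gen_mulZl linearZ /=.
have n'N : (x^-1 * g * n * (x^-1 * g)^-1 \in N)%g by rewrite datJ.
rewrite gen_mul_same // linearZ /= translate_genE ?(groupM n'N) //.
have -> : act g (block_gen n) = block_eps Y m p (x^-1 * g)%g n *:
    act x (block_gen (x^-1 * g * n * (x^-1 * g)^-1)%g).
  by rewrite -linearZ /= -(block_epsE tH nN) -comp_lfunE -yd_actM mulKVg.
rewrite amulZl -(act_mul rF).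
by rewrite (block_gammaE n'N lN) [act x (_ *: _)]linearZ.
Qed.

Lemma counit_translate_gen v : e (F v) = e p *: gen_counit d v.
Proof.
rewrite -comp_lfunE -scale_lfunE; congr (fun_of_lfun _ v).
apply: gen_ext => g n nN; rewrite comp_lfunE scale_lfunE translate_genE //.
rewrite (e_act rF) gen_counitE //; case: eqP => [->|/eqP n1].
  by rewrite block_gen1 /GRing.scale /= mulr1.
have /in_blockP[ng _] := block_gen_in nN.
by rewrite (e_gr rF ng) // scaler0.
Qed.

Section Decomposition.
Variables (I : finType) (r : I -> gT).
Hypothesis rP : is_coset_decomposition d r.

Lemma translate_gen_one : F (gen_one d r) = u 1.
Proof.
rewrite -(sum_translates rF pP rP) linear_sum; apply: eq_bigr => i _.
by rewrite /= translate_genE // block_gen1.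
Qed.

(** A multiplicative map that respects forms up to a nonzero scalar is injective
    when the form of its source is nondegenerate. *)
Lemma translate_gen_inj : lker F == 0%VS.
Proof.
rewrite -subv0; apply/subvP => v; rewrite memv_ker memv0 => /eqP Fv.
have [//|v0] := eqVneq v 0; have [w] := form_nondegl (gen_rigid_frobenius rP) v0.
rewrite /amul gen_mulmE => /eqP ew; case: ew; apply/eqP.
have := counit_translate_gen (gen_mul d v w).
rewrite translate_gen_mul Fv amul0l linear0 => /esym/eqP.
by rewrite scaler_eq0 (negbTE (e_p_neq0 rF pP)).
Qed.

(** Cut by the translates of [p], an element is a sum of elements that a group
    element moves into the block of [p], where the [block_gen n] span. *)
Lemma translate_gen_surj v : v \in limg F.
Proof.
rewrite -[v](amul1l rF) -(sum_translates rF pP rP) amul_suml memv_suml // => i _.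
rewrite -[v](yd_actKV Y (r i)) -(act_mul rF) -[_ v](yd_comp_sum Y).
rewrite amul_sumr linear_sum memv_suml // => g _ /=.
set w := _ ** _; have wg : in_block Y m p g w by apply: (block_comp rF pP).
have [->|w0] := eqVneq w 0; first by rewrite linear0 mem0v.
have gN : g \in N by apply/(suppP rF pP); exists w.
have [a ->] := block_line rF pP (block_gen_in gN) (block_gen_neq0 gN) wg.
by rewrite linearZ rpredZ //= -translate_genE // memv_img ?memvf.
Qed.

Lemma translate_genK : (F^-1 \o F)%VF = \1%VF.
Proof. by apply: lker0_compVf; apply: translate_gen_inj. Qed.

Lemma translate_genVK : (F \o F^-1)%VF = \1%VF.
Proof.
apply/lfunP => v; rewrite comp_lfunE id_lfunE limg_lfunVK //.
exact: translate_gen_surj.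
Qed.

Let FK v : (F^-1)%VF (F v) = v.
Proof. by rewrite -comp_lfunE translate_genK id_lfunE. Qed.

Let FVK v : F ((F^-1)%VF v) = v.
Proof. by rewrite -comp_lfunE translate_genVK id_lfunE. Qed.

(** The comultiplication is determined by the product and the form, and a form
    multiplied by [e p] corresponds to a comultiplication divided by [e p]. *)
Lemma comul_translate_gen w : tensl F F (gen_comul d w) = e p *: D (F w).
Proof.
apply: (tens_form_eq rF) => a; rewrite linearZ [in RHS]linearZ /= (comul_form rF).
rewrite -[a]FVK -translate_gen_mul; move: ((F^-1)%VF a) => {}a.
have := comul_form (gen_rigid_frobenius rP) a w.
rewrite -[RHS]/(gen_mulm d _) gen_mulmE => <-; rewrite -linearZ.
rewrite -[LHS]comp_lfunE -[LHS]comp_lfunE.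
have -> : (tunitl V \o (tensl (e \o lmul m (F a)) \1) \o tensl F F)%VF =
  (F \o (e p *: (tunitl (Asp d) \o tensl (gen_counit d \o lmul (gen_mulm d) a) \1)))%VF.
  apply: lfun_tensP => x y; rewrite !comp_lfunE scale_lfunE comp_lfunE !tensl_tens.
  rewrite !tunitl_tens !comp_lfunE !lmulE !id_lfunE -translate_gen_mul.
  by rewrite counit_translate_gen !linearZ /= scalerA /amul gen_mulmE.
by rewrite comp_lfunE scale_lfunE comp_lfunE.
Qed.

Lemma translate_gen_iso :
  is_rigid_frobenius_iso Y m u D e (gen_yd d) (gen_mulm d) (gen_unit d r)
    (gen_comul d) (gen_counit d) (F^-1)%VF.
Proof.
split.
- split; first exact: ydmor_inv translate_gen_mor translate_genK translate_genVK.
  by exists F; split;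
    [exact: translate_gen_mor | exact: translate_genVK | exact: translate_genK].
- apply: lfun_tensP => v w; rewrite !comp_lfunE tensl_tens gen_mulmE.
  by rewrite -[RHS]FK translate_gen_mul !FVK.
- by apply: lfun_unitP; rewrite comp_lfunE scal_lfunE scale1r -translate_gen_one FK.
exists (e p : k); first exact: (e_p_neq0 rF pP).
split; apply/lfunP => v.
  rewrite comp_lfunE scale_lfunE comp_lfunE -{2}[v]FVK -linearZ /= -comul_translate_gen.
  rewrite -[RHS]comp_lfunE (_ : (_ \o _)%VF = \1%VF) ?id_lfunE //.
  by apply: lfun_tensP => x y; rewrite comp_lfunE !tensl_tens !FK id_lfunE.
rewrite comp_lfunE scale_lfunE -[v in RHS]FVK counit_translate_gen scalerA.
by rewrite mulVf ?scale1r // (e_p_neq0 rF pP).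
Qed.

End Decomposition.

End Classification.

Theorem theorem6p14 (k : closedFieldType) (gT : finGroupType) :
  (forall (d : datum k gT) (I : finType) (r : I -> gT),
     is_coset_decomposition d r ->
     exists (Y : ydStruct gT (Asp d))
            (m : 'Hom(tensv (Asp d) (Asp d), Asp d)) (u : 'Hom(k^o, Asp d)),
       [/\ is_A_algebra r Y m u,
           is_yd_algebra Y m u,
           is_connected Y,
           is_commutative Y m &
           exists (D : 'Hom(Asp d, tensv (Asp d) (Asp d)))
                  (e : 'Hom(Asp d, k^o)),
             is_A_coalgebra D e /\ is_rigid_frobenius Y m u D e])
  /\
  (forall (V : vectType k) (Y : ydStruct gT V)
          (m : 'Hom(tensv V V, V)) (u : 'Hom(k^o, V))
          (D : 'Hom(V, tensv V V)) (e : 'Hom(V, k^o)),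
     is_rigid_frobenius Y m u D e ->
     exists d : datum k gT,
       forall (I : finType) (r : I -> gT), is_coset_decomposition d r ->
       exists (Y' : ydStruct gT (Asp d))
              (m' : 'Hom(tensv (Asp d) (Asp d), Asp d))
              (u' : 'Hom(k^o, Asp d))
              (D' : 'Hom(Asp d, tensv (Asp d) (Asp d)))
              (e' : 'Hom(Asp d, k^o)),
         [/\ is_A_algebra r Y' m' u', is_A_coalgebra D' e' &
             exists f : 'Hom(V, Asp d),
               is_rigid_frobenius_iso Y m u D e Y' m' u' D' e' f]).
Proof.
split=> [d I r rP|V Y m u D e rF].
  exists (gen_yd d), (gen_mulm d), (gen_unit d r); split.
  - exact: gen_is_A_algebra.
  - exact: gen_algebra.
  - exact: gen_connected rP.
  - exact: gen_commutative.
  exists (gen_comul d), (gen_counit d).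
  by split; [exact: gen_is_A_coalgebra | exact: gen_rigid_frobenius].
have [p pP] := primitive1_exists rF.
exists (rigid_datum rF pP) => I r rP.
do 5! eexists; split; [exact: gen_is_A_algebra|exact: gen_is_A_coalgebra|].
by exists (translate_gen rF pP)^-1%VF; apply: translate_gen_iso.
Qed.
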